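(* Let $(\Omega,\mathcal{F},\mathbb{P})$ be a complete probability space, $t_0<T$, $x_0$ a random variable and $a$ a stochastic process on $[t_0,T]$, and let $x(t,\omega)=x_0(\omega)\mathrm{e}^{\int_{t_0}^t a(s,\omega)\mathrm{d} s}$. Assume: (H1) $a\in \mathrm{L}^2([t_0,T]\times\Omega)$; (H2) for every $N\ge2$, $x_0$, $\xi_1$ and $(\xi_2,\ldots,\xi_N)$ are absolutely continuous and independent; (H3) the density $f_{\xi_1}$ of $\xi_1$ is Lipschitz on $\mathbb{R}$; (H4) $\int_{t_0}^t\phi_1(s)\,\mathrm{d} s\ne0$ for all $t\in(t_0,T]$. Then for each fixed $t\in(t_0,T]$, the sequence \[ f_1^N(x,t)=\int_{\mathbb{R}^N} f_0\big(x\,\mathrm{e}^{-K_a(t,\pmb{\xi}_N)}\big)f_{\pmb{\xi}_N}(\pmb{\xi}_N)\,\mathrm{e}^{-K_a(t,\pmb{\xi}_N)}\,\mathrm{d}\pmb{\xi}_N \] (where $f_0$ is the density of $x_0$) converges in $\mathrm{L}^\infty(J)$, for every $\delta>0$ and every bounded set $J\subseteq\mathbb{R}\setminus[-\delta,\delta]$, to a probability density $f_1(\cdot,t)$ of $x(t,\cdot)$.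
   Context: Karhunen–Loève expansion: for $a\in \mathrm{L}^2([t_0,T]\times\Omega)$ write $a(t,\omega)=\mu_a(t)+\sum_{j=1}^\infty\sqrt{\nu_j}\,\phi_j(t)\xi_j(\omega)$ (convergence in $\mathrm{L}^2([t_0,T]\times\Omega)$), where $\mu_a(t)=\mathbb{E}[a(t)]$, $\{(\nu_j,\phi_j)\}$ are the (nonnegative) eigenvalue/eigenfunction pairs of the covariance operator $\mathcal{C}f(t)=\int_{t_0}^T\mathrm{Cov}[a(t),a(s)]f(s)\,\mathrm{d} s$ on $\mathrm{L}^2([t_0,T])$ with $\{\phi_j\}$ an orthonormal basis, and $\xi_j$ are zero-mean, unit-variance, pairwise uncorrelated random variables; the pairs may be enumerated in any order (here $\nu_1>0$). $\pmb{\xi}_N=(\xi_1,\ldots,\xi_N)$, $f_{\pmb{\xi}_N}$ its density, $K_a(t,\pmb{\xi}_N)=\int_{t_0}^t\big(\mu_a(s)+\sum_{j=1}^N\sqrt{\nu_j}\phi_j(s)\xi_j\big)\mathrm{d} s$. *)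

(* Defs.v *)
From HB Require Import structures.
From mathcomp Require Import all_boot all_order all_algebra.
From mathcomp Require Import all_classical all_reals all_analysis.
Set Implicit Arguments. Unset Strict Implicit. Unset Printing Implicit Defensive.
Import Order.TTheory GRing.Theory Num.Theory.
Import numFieldNormedType.Exports.
Local Open Scope classical_set_scope.
Local Open Scope ring_scope.

(* Integral over R^n (n.-tuple R, with its product Borel sigma-algebra),
   defined as the iterated Lebesgue integral; by Tonelli this is the
   integral against n-dimensional Lebesgue measure for the nonnegative
   measurable integrands used below. *)
Fixpoint lebesgue_integralN (R : realType) (n : nat) :
    (n.-tuple R -> \bar R) -> \bar R :=
  match n with
  | 0 => fun g => g [tuple]
  | n'.+1 => fun g =>
      (\int[@lebesgue_measure R]_x lebesgue_integralN (fun v => g (cons_tuple x v)))%E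
  end.

Definition is_density (d : measure_display) (T : measurableType d) (R : realType)
    (P : probability T R) (X : T -> R) (f : R -> R) : Prop :=
  [/\ measurable_fun setT X, measurable_fun setT f, (forall y, 0 <= f y) &
      forall A : set R, measurable A ->
        P (X @^-1` A) = (\int[@lebesgue_measure R]_(y in A) (f y)%:E)%E].

Definition is_densityN (d : measure_display) (T : measurableType d) (R : realType)
    (P : probability T R) (n : nat) (X : T -> n.-tuple R) (f : n.-tuple R -> R) : Prop :=
  [/\ measurable_fun setT X, measurable_fun setT f, (forall v, 0 <= f v) &
      forall A : set (n.-tuple R), measurable A ->
        P (X @^-1` A) = lebesgue_integralN (fun v => ((\1_A v : R) * f v)%:E)].

(* the random vector xi_N = (xi_1, ..., xi_N); paper index j+1 <-> Rocq index j *)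
Definition xivec (d : measure_display) (T : measurableType d) (R : realType)
    (xi : nat -> T -> R) (N : nat) : T -> N.-tuple R :=
  fun w => [tuple xi (nat_of_ord i) w | i < N].

Definition xitail (d : measure_display) (T : measurableType d) (R : realType)
    (xi : nat -> T -> R) (N : nat) : T -> N.-1.-tuple R :=
  fun w => [tuple xi (nat_of_ord i).+1 w | i < N.-1].

Definition K_a (R : realType) (mu : R -> R) (nu : nat -> R) (phi : nat -> R -> R)
    (t0 t : R) (N : nat) (v : N.-tuple R) : R :=
  Rintegral (@lebesgue_measure R) `[t0, t]
    (fun s => mu s + \sum_(j < N) Num.sqrt (nu j) * phi j s * tnth v j).

Definition f1N (R : realType) (f0 : R -> R) (mu : R -> R) (nu : nat -> R)
    (phi : nat -> R -> R) (t0 t : R) (N : nat) (fxiN : N.-tuple R -> R) (x : R)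
    : \bar R :=
  lebesgue_integralN (fun v =>
    (f0 (x * expR (- K_a mu nu phi t0 t v)) * fxiN v
       * expR (- K_a mu nu phi t0 t v))%:E).

Definition covariance_fn (d : measure_display) (T : measurableType d) (R : realType)
    (P : probability T R) (a : R -> T -> R) (mu : R -> R) (t s : R) : R :=
  Rintegral P setT (fun w => (a t w - mu t) * (a s w - mu s)).

Definition sol (d : measure_display) (T : measurableType d) (R : realType)
    (x0 : T -> R) (a : R -> T -> R) (t0 t : R) : T -> R :=
  fun w => x0 w * expR (Rintegral (@lebesgue_measure R) `[t0, t] (fun s => a s w)).

(* Main.v *)
Require Import Defs.
From HB Require Import structures.
From mathcomp Require Import all_boot all_order all_algebra.
From mathcomp Require Import all_classical all_reals all_analysis.
From mathcomp Require Import measurable_realfun lra ring.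
Set Implicit Arguments. Unset Strict Implicit. Unset Printing Implicit Defensive.
Import Order.TTheory GRing.Theory Num.Theory.
Import numFieldNormedType.Exports.
Local Open Scope classical_set_scope.
Local Open Scope ring_scope.

(* Write V = int_t0^t a, V_N = K_a(xi_N) = m + c xi_1 + Z_N, where m is the
   integral of mu, c = sqrt nu_1 int_t0^t phi_1 is nonzero, and Z_N depends only
   on (xi_2, ..., xi_N); put Z = V - m - c xi_1. The Karhunen-Loeve convergence
   gives E|Z_N - Z| = E|V_N - V| -> 0, and independence passes to such limits,
   so xi_1 is independent of Z and x0 is independent of V. Hence V_N and V have
   the densities
     q_N(v) = E[f_xi1((v - m - Z_N) / c)] / |c|,
     q(v) = E[f_xi1((v - m - Z) / c)] / |c|,
   which satisfy |q_N - q| <= L E|Z_N - Z| / c^2 by the Lipschitz hypothesis.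
   Moreover f1N(y) = E[f0(y exp(-V_N)) exp(-V_N)]
                   = int f0(y exp(-v)) exp(-v) q_N(v) dv,
   and the same formula with q in place of q_N is a density of x0 exp(V).
   Since int f0(y exp(-v)) exp(-v) dv <= 1/|y|, the two differ by at most
   L E|Z_N - Z| / (c^2 |y|), which is uniformly small for |y| > delta. *)

(** * Measures given by a density *)

Section density.
Local Open Scope ereal_scope.
Context {d : measure_display} {T : measurableType d} {R : realType}.
Variable mu : {measure set T -> \bar R}.
Variable f : T -> R.
Hypothesis mf : measurable_fun setT f.
Hypothesis f0 : forall x, (0 <= f x)%R.

Import HBNNSimple.

(** Both sides are limits along the same increasing simple approximations of [h]; for a simple
    function the claim reduces, level set by level set, to the hypothesis. [nu] is left arbitrary so
    that it can be the law of a random variable or a restricted probability. *)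
Lemma ge0_integral_density (nu : {measure set T -> \bar R}) (h : T -> \bar R) :
  (forall A, measurable A -> nu A = \int[mu]_(x in A) (f x)%:E) ->
  measurable_fun setT h -> (forall x, 0 <= h x) ->
  \int[nu]_x h x = \int[mu]_x (h x * (f x)%:E).
Proof.
move=> nuE mh h0.
pose hn := nnsfun_approx measurableT mh.
have mEf : measurable_fun setT (EFin \o f) by exact/measurable_EFinP.
have -> : \int[nu]_x h x = lim (\int[nu]_x (EFin \o hn n) x @[n --> \oo]).
  have hE x : h x = lim ((EFin \o hn n) x @[n --> \oo]).
    by apply/esym/cvg_lim => //; exact: cvg_nnsfun_approx.
  under eq_integral do rewrite hE.
  apply: monotone_convergence => //.
  - by move=> n; exact/measurable_EFinP.
  - by move=> n x _ //=; rewrite lee_fin.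
  - by move=> x _ a b ab; rewrite lee_fin; exact/lefP/nd_nnsfun_approx.
have -> : \int[mu]_x (h x * (f x)%:E) =
    lim (\int[mu]_x ((EFin \o hn n) x * (f x)%:E) @[n --> \oo]).
  have hf x : h x * (f x)%:E = lim ((EFin \o hn n) x * (f x)%:E @[n --> \oo]).
    by apply/esym/cvg_lim => //; apply: cvgeZr => //; exact: cvg_nnsfun_approx.
  under eq_integral do rewrite hf.
  apply: monotone_convergence => [//| | |].
  - by move=> n; apply/emeasurable_funM => //; exact/measurable_EFinP.
  - by move=> n x _ /=; rewrite mule_ge0 ?lee_fin.
  - move=> x _ a b ab/=; rewrite lee_wpmul2r ?lee_fin//.
    exact/lefP/nd_nnsfun_approx.
congr (lim (_ @ \oo)); apply/funext => n.
transitivity (\int[nu]_x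
   (\sum_(y \in range (hn n)) (y * \1_(hn n @^-1` [set y]) x)%:E)).
  by apply: eq_integral => t _; rewrite /= fimfunE -fsumEFin.
rewrite ge0_integral_fsum//; last first.
- by move=> m y _; exact: nnfun_muleindic_ge0.
- by move=> y; apply/measurable_EFinP; exact: measurable_funM.
transitivity (\int[mu]_x (\sum_(y \in range (hn n))
    (y * \1_(hn n @^-1` [set y]) x)%:E * (f x)%:E)); last first.
  apply: eq_integral => x _.
  rewrite -ge0_mule_fsuml => [|y]; last exact: nnfun_muleindic_ge0.
  by rewrite fsumEFin // -(fimfunE _ x).
rewrite ge0_integral_fsum//; last 2 first.
  - move=> y; apply: emeasurable_funM => //.
    by apply/measurable_EFinP; exact: measurable_funM.
  - by move=> m y _; rewrite mule_ge0 ?lee_fin//; exact: nnfun_muleindic_ge0.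
apply: eq_fsbigr => r rhn.
under [LHS]eq_integral do rewrite EFinM.
rewrite integralZl_indic_nnsfun => //.
under [RHS]eq_integral do rewrite EFinM -muleA.
rewrite ge0_integralZl//.
- under [in RHS]eq_integral do rewrite muleC.
  rewrite integral_indic// setIT nuE//; congr (_ * _).
  by rewrite integral_mkcond; apply: eq_integral => x _; rewrite epatch_indic.
- by apply: emeasurable_funM => //; exact/measurable_EFinP.
- by move=> t _; rewrite mule_ge0 ?lee_fin.
- by move: rhn; rewrite inE => -[t _ <-]; rewrite lee_fin.
Qed.

Lemma ex_density_measure : exists nu : {measure set T -> \bar R},
  forall A, measurable A -> nu A = \int[mu]_(x in A) (f x)%:E.
Proof.
pose m A := \int[mu]_(x in A) (f x)%:E.
have m0 : m set0 = 0 by rewrite /m integral_set0.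
have mge0 A : 0 <= m A by apply: integral_ge0 => x _; rewrite lee_fin.
have msigma : semi_sigma_additive m.
  move=> F mF tF mUF; rewrite /m ge0_integral_bigcup//; last 2 first.
    by apply/measurable_funTS/measurable_EFinP.
    by move=> x _; rewrite lee_fin.
  by apply: is_cvg_nneseries => n _ _; exact: mge0.
pose nu : {measure set T -> \bar R} :=
  HB.pack m (isMeasure.Build _ _ _ m m0 mge0 msigma).
by exists nu.
Qed.

End density.

(** * Integrals that agree off a null set *)

Section ae_integral.
Local Open Scope ereal_scope.
Context {d : measure_display} {T : measurableType d} {R : realType}.
Variable mu : {measure set T -> \bar R}.

Import HBNNSimple.

(** The integral of a nonnegative function, measurable or not, is a supremum over the simple
    functions below it. Multiplying one below [f] by the indicator of the complement of [N] puts it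
    below [g] and keeps its integral. *)
Let ge0_le_integral_off_null (N : set T) (f g : T -> \bar R) :
  measurable N -> mu N = 0 -> (forall x, 0 <= f x) -> (forall x, 0 <= g x) ->
  (forall x, ~ N x -> f x = g x) -> \int[mu]_x f x <= \int[mu]_x g x.
Proof.
move=> mN N0 f0 g0 fg; rewrite !ge0_integralTE//.
apply: ge_ereal_sup => _ [h hf <-].
have mNC : measurable (~` N) by exact: measurableC.
apply: ereal_sup_ubound; exists (proj_nnsfun h mNC) => /=.
  move=> x; rewrite mindicE; have [Nx|Nx] := pselect (N x).
    by rewrite memNset ?mulr0//=; exact.
  by rewrite mem_set// mulr1 -fg.
rewrite -!integralT_nnsfun; apply: ge0_ae_eq_integral => //=.
- exact/measurable_EFinP/(measurable_funP (proj_nnsfun h mNC)).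
- exact/measurable_EFinP.
- by move=> x _; rewrite lee_fin mulr_ge0.
- by move=> x _; rewrite lee_fin.
exists N; split => // x /=; apply: contra_notP => Nx _.
  by rewrite mindicE mem_set// mulr1.
Qed.

(* Unlike [ae_eq_integral], no measurability of the integrands is required. *)
Lemma eq_integral_off_null (N D : set T) (f g : T -> \bar R) :
  measurable N -> mu N = 0 -> (forall x, D x -> ~ N x -> f x = g x) ->
  \int[mu]_(x in D) f x = \int[mu]_(x in D) g x.
Proof.
move=> mN N0 fg.
suff H (f' g' : T -> \bar R) : (forall x, D x -> ~ N x -> f' x = g' x) ->
    (forall x, 0 <= f' x) -> (forall x, 0 <= g' x) ->
    \int[mu]_(x in D) f' x = \int[mu]_(x in D) g' x.
  rewrite integralE [RHS]integralE; congr (_ - _); apply: H => // x Dx Nx.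
    by rewrite !funeposE fg.
  by rewrite !funenegE fg.
move=> {}fg f0 g0; rewrite integral_mkcond [RHS]integral_mkcond.
apply/eqP; rewrite eq_le; apply/andP; split;
  apply: (@ge0_le_integral_off_null N) => //;
  by [move=> x; rewrite patchE; case: ifPn|
      move=> x Nx; rewrite !patchE; case: ifPn => // /set_mem Dx; rewrite fg].
Qed.

End ae_integral.

(** * Affine and exponential substitutions on the real line *)

Section lebesgue_change_of_variables.
Context {R : realType}.
Local Notation mu := (@lebesgue_measure R).

(** [|c|] times the image of Lebesgue measure under the affine map gives each half-open interval its
    length, hence is Lebesgue measure by uniqueness. *)
Lemma ge0_integral_affine (c b : R) (F : R -> \bar R) : c != 0 ->
  measurable_fun setT F -> (forall x, 0 <= F x)%E ->
  (\int[mu]_x (F (c * x + b)%R * `|c|%:E) = \int[mu]_x F x)%E.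
Proof.
move=> c0 mF F0.
have mphi : measurable_fun (setT : set (measurableTypeR R))
    ((fun x => c * x + b) : measurableTypeR R -> measurableTypeR R).
  by apply: measurable_funD => //; exact: measurable_funM.
pose m0 : {measure set (measurableTypeR R) -> \bar R} :=
  measure_function_pushforward__canonical__measure_function_Measure mu mphi.
have nc0 : 0 <= `|c| by [].
pose m := mscale (NngNum nc0) m0.
have mE A : measurable A -> mu A = m A.
  move=> mA; apply: lebesgue_measure_unique => //= _ [[p q]] _ <-.
  rewrite /m/= /mscale/= /pushforward lebesgue_measure_itv/= lte_fin.
  have [cpos|] := ltP 0 c; last rewrite le_eqVlt (negbTE c0)/= => cneg.
    rewrite (_ : _ @^-1` _ = `](p - b) / c, (q - b) / c]%classic); last first.
      apply/seteqP; split => x /=; rewrite !in_itv/= => /andP[h1 h2];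
        apply/andP; split; move: h1 h2;
        rewrite ?ltr_pdivrMr ?ler_pdivlMr// => h1 h2; lra.
    rewrite lebesgue_measure_itv/= lte_fin ltr_pM2r ?invr_gt0// ltrD2r.
    case: ifPn => pq; last by rewrite mule0.
    rewrite -!EFinB -EFinM gtr0_norm//; congr EFin.
    by rewrite -mulrBl mulrC mulfVK//; lra.
  (* For [c < 0] the map reverses the order: the endpoints swap and the closed end moves to the
     left. *)
  rewrite (_ : _ @^-1` _ = `[(q - b) / c, (p - b) / c[%classic); last first.
    apply/seteqP; split => x /=; rewrite !in_itv/= => /andP[h1 h2];
      apply/andP; split; move: h1 h2;
      rewrite ?ltr_ndivlMr ?ler_ndivrMr// => h1 h2; lra.
  rewrite lebesgue_measure_itv/= lte_fin ltr_nM2r ?invr_lt0// ltrD2r.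
  case: ifPn => pq; last by rewrite mule0.
  rewrite -!EFinB -EFinM ltr0_norm//; congr EFin.
  by rewrite -mulrBl mulrC mulrN mulfVK//; lra.
rewrite [RHS](eq_measure_integral m); last by move=> A mA _; exact: mE.
rewrite ge0_integral_mscale//.
have -> : (\int[m0]_x F x = \int[mu]_x F (c * x + b)%R)%E.
  have := ge0_integral_pushforward mphi mu measurableT mF (fun y _ => F0 y).
  by rewrite preimage_setT.
rewrite ge0_integralZr//; first exact: muleC.
exact: (measurableT_comp mF mphi).
Qed.

Lemma measurable_invr_gt0 (a : R) : 0 <= a ->
  measurable_fun (`]a, +oo[ : set R) (@GRing.inv R).
Proof.
move=> a0; apply: (eq_measurable_fun (fun x => expR (- ln x))).
  move=> x; rewrite inE/= in_itv/= andbT => ax.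
  by rewrite expRN lnK// posrE (le_lt_trans a0 ax).
apply: measurable_funTS; apply: measurableT_comp => //.
by apply: measurableT_comp => //; exact: measurable_ln.
Qed.

Lemma integral_invr (a b : R) : 0 < a -> a < b ->
  (\int[mu]_(x in `]a, b]) (x^-1)%:E = (ln b - ln a)%:E)%E.
Proof.
move=> a0 ab.
rewrite integral_itv_obnd_cbnd; last first.
  apply/measurable_EFinP.
  by apply: measurable_funS (measurable_invr_gt0 (ltW a0)) => //; exact: subset_itvl.
have pos x : x \in `[a, b] -> 0 < x.
  by rewrite in_itv/= => /andP[ax _]; exact: lt_le_trans ax.
rewrite EFinB; apply: continuous_FTC2 => //.
- apply: continuous_in_subspaceT => x /[!inE]/= /pos x0.
  by apply: inv_continuous; rewrite gt_eqF.
- split.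
  + move=> x /subset_itv_oo_cc /pos x0.
    by apply: ex_derive; exact: is_derive1_ln.
  + apply: cvg_at_right_filter; exact: continuous_ln.
  + by apply: cvg_at_left_filter; apply: continuous_ln; exact: lt_trans ab.
- move=> x /subset_itv_oo_cc /pos x0.
  by rewrite derive1E; have [_ ->] := is_derive1_ln x0.
Qed.

(* the substitution [x = expR v] *)
Lemma ge0_integral_ln (G : R -> \bar R) :
  measurable_fun setT G -> (forall x, 0 <= G x)%E ->
  (\int[mu]_v G v = \int[mu]_(x in `]0%R, +oo[) (G (ln x) * (x^-1)%:E))%E.
Proof.
move=> mG G0.
(* [g] is the density of the measure dx/x, whose image under [ln] gives []p, q]] the mass
   [ln (expR q) - ln (expR p) = q - p]. Since [g] vanishes off the positive half-line, the default
   value of [ln] there is harmless. *)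
pose g := (fun x : R => x^-1) \_ (`]0, +oo[ : set R).
have mg : measurable_fun setT g.
  by apply: (iffLR (measurable_restrictT _ _)) => //; exact: measurable_invr_gt0.
have g0 x : 0 <= g x.
  by rewrite /g patchE; case: ifPn => //; rewrite inE/= in_itv/= andbT invr_ge0 => /ltW.
have [nu nuE] := ex_density_measure mu mg g0.
have mln : measurable_fun (setT : set (measurableTypeR R))
    (@ln R : measurableTypeR R -> measurableTypeR R) by exact: measurable_ln.
pose m : {measure set (measurableTypeR R) -> \bar R} :=
  measure_function_pushforward__canonical__measure_function_Measure nu mln.
have mE A : measurable A -> mu A = m A.
  move=> mA; apply: lebesgue_measure_unique => //= _ [[p q]] _ <-.
  rewrite /m/= /pushforward nuE; last by rewrite -[X in measurable X]setTI; exact: (mln measurableT).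
  rewrite lebesgue_measure_itv/= lte_fin.
  rewrite integral_mkcond (_ : _ \_ _ =
      (fun x => (x^-1)%:E) \_ (`]expR p, expR q] : set R)).
    rewrite -integral_mkcond; case: ifPn => pq.
      by rewrite integral_invr ?expR_gt0 ?ltr_expR// !expRK EFinB.
    by rewrite set_itv_ge ?integral_set0// -leNgt bnd_simp ler_expR leNgt.
  apply/funext => x; rewrite /g !patchE.
  have [x0|x0] := ltP 0 x.
    rewrite (_ : (x \in `]0, +oo[%classic) = true); last first.
      by apply: mem_set; rewrite /= in_itv/= x0.
    congr (if _ then _ else _).
    apply/idP/idP => /set_mem; rewrite /= in_itv/= => /andP[h1 h2];
      apply: mem_set; rewrite /= in_itv/=.
      by rewrite -[x]lnK// ltr_expR ler_expR h1 h2.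
    by rewrite -ltr_expR -ler_expR lnK// h1 h2.
  rewrite (_ : (x \in `]0, +oo[%classic) = false); last first.
    by apply/negP => /set_mem; rewrite /= in_itv/= andbT ltNge x0.
  rewrite if_same ifF//; apply/negP => /set_mem; rewrite /= in_itv/= => /andP[h1 _].
  by have := lt_le_trans h1 x0; rewrite ltNge expR_ge0.
rewrite [LHS](eq_measure_integral m); last by move=> A mA _; exact: mE.
have -> : (\int[m]_x G x = \int[nu]_x G (ln x))%E.
  have := ge0_integral_pushforward mln nu measurableT mG (fun y _ => G0 y).
  by rewrite preimage_setT.
rewrite (@ge0_integral_density _ _ _ mu g mg g0 nu)//; last exact: (measurableT_comp mG mln).
rewrite [RHS]integral_mkcond; apply: eq_integral => x _.
by rewrite /g !patchE; case: ifPn => //; rewrite mule0.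
Qed.

(** Replacing [v] by [- v] and then setting [y = expR v] gives the integral of [f (x * y)] over
    [y > 0]. Enlarging the domain to the whole line costs the equality; rescaling by [x] produces
    the factor. *)
Lemma le_integral_dilation (f : R -> R) (x : R) : x != 0 ->
  measurable_fun setT f -> (forall y, 0 <= f y) ->
  (\int[mu]_v (f (x * expR (- v)) * expR (- v))%:E <=
   `|x|^-1%:E * \int[mu]_y (f y)%:E)%E.
Proof.
move=> x0 mf f0.
have mfx : measurable_fun setT (fun y => (f (x * y)%R)%:E).
  by apply/measurable_EFinP; apply: measurableT_comp => //; exact: measurable_funM.
pose G v := (f (x * expR v) * expR v)%:E.
have mG : measurable_fun setT G.
  apply/measurable_EFinP; apply: measurable_funM => //.
  by apply: measurableT_comp => //; apply: measurable_funM.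
have G0 v : (0 <= G v)%E by rewrite lee_fin mulr_ge0// expR_ge0.
have -> : (\int[mu]_v (f (x * expR (- v)) * expR (- v))%:E = \int[mu]_v G v)%E.
  rewrite -(@ge0_integral_affine (-1) 0 G)//.
  apply: eq_integral => v _.
  by rewrite normrN normr1 mule1 mulN1r addr0.
rewrite ge0_integral_ln//.
apply: (@le_trans _ _ (\int[mu]_y (f (x * y))%:E)%E).
  apply: (@le_trans _ _ (\int[mu]_(y in `]0%R, +oo[) (f (x * y))%:E)%E).
    rewrite le_eqVlt; apply/orP; left; apply/eqP; apply: eq_integral => y.
    rewrite inE/= in_itv/= andbT => y0.
    by rewrite /G lnK// -EFinM mulfK// gt_eqF.
  by apply: ge0_subset_integral => // y _; rewrite lee_fin.
have mEf : measurable_fun setT (EFin \o f) by exact/measurable_EFinP.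
rewrite -(ge0_integral_affine 0 x0 mEf); last by move=> y; rewrite lee_fin.
under [in leRHS]eq_integral do rewrite addr0.
rewrite ge0_integralZr//; last by move=> y _; rewrite lee_fin.
by rewrite muleCA -EFinM mulVf ?normr_eq0// mule1.
Qed.

End lebesgue_change_of_variables.

(** * Lebesgue measure on tuples *)

Lemma sigma_finite_product (d1 d2 : measure_display) (T1 : measurableType d1)
    (T2 : measurableType d2) (R : realType)
    (m1 : {sigma_finite_measure set T1 -> \bar R})
    (m2 : {sigma_finite_measure set T2 -> \bar R}) :
  sigma_finite setT (m1 \x m2)%E.
Proof.
have /sigma_finiteP[F [TF ndF Foo]] := sigma_finiteT m1.
have /sigma_finiteP[G [TG ndG Goo]] := sigma_finiteT m2.
exists (fun n => F n `*` G n).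
  apply/seteqP; split=> [[x y] _|//]; have : setT x by []; have : setT y by [].
  rewrite {1}TG {1}TF => -[k _ Gky] [n _ Fnx]; exists (maxn n k) => //; split.
  - by move: (x) Fnx; exact/subsetPset/ndF/leq_maxl.
  - by move: (y) Gky; exact/subsetPset/ndG/leq_maxr.
move=> k; have [mF Fk] := Foo k; have [mG Gk] := Goo k.
split; first exact: measurableX.
by rewrite product_measure1E// lte_mul_pinfty// ge0_fin_numE.
Qed.

(** The measure on [n.+1]-tuples is the image under cons of the product of Lebesgue measure with the
    one on [n]-tuples, and Tonelli peels off one coordinate. Sigma-finiteness is carried along so
    that the next product can be formed. *)
Lemma ex_lebesgue_measureN (R : realType) (n : nat) :
  exists mu : {sigma_finite_measure set (n.-tuple R) -> \bar R},
    forall g : n.-tuple R -> \bar R,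
      measurable_fun setT g -> (forall v, 0 <= g v)%E ->
      lebesgue_integralN g = (\int[mu]_v g v)%E.
Proof.
elim: n => [|n [mu muE]].
  exists (\d_ ([tuple] : 0.-tuple R)) => g mg g0 /=.
  by rewrite integral_dirac// diracT mul1e.
pose cs (p : measurableTypeR R * n.-tuple R) : n.+1.-tuple R :=
  [the n.+1.-tuple R of p.1 :: p.2].
have mcs : measurable_fun setT cs.
  by apply: measurable_cons; [exact: measurable_fst|exact: measurable_snd].
pose m : {measure set (n.+1.-tuple R) -> \bar R} :=
  measure_function_pushforward__canonical__measure_function_Measure
    (@lebesgue_measure R \x mu)%E mcs.
(* Preimages under [uncs] of the exhausting sets keep their mass, because [uncs] undoes [cs]. *)
pose uncs (v : n.+1.-tuple R) : measurableTypeR R * n.-tuple R :=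
  (thead v, [tuple of behead v]).
have muncs : measurable_fun setT uncs.
  by apply: measurable_fun_pair; [exact: measurable_tnth|exact: measurable_behead].
have csK p : uncs (cs p) = p.
  by case: p => x v; rewrite /uncs /cs/= theadE; congr pair; apply: val_inj.
have sfm : sigma_finite setT m.
  have [F FT Foo] : sigma_finite setT (@lebesgue_measure R \x mu)%E.
    exact: sigma_finite_product.
  exists (fun k => uncs @^-1` F k).
    by rewrite -preimage_bigcup -FT preimage_setT.
  move=> k; have [mF Fk] := Foo k; split.
    by rewrite -[X in measurable X]setTI; exact: muncs.
  rewrite /m/= /pushforward -comp_preimage (_ : uncs \o cs = idfun)//.
  by apply/funext => p /=; exact: csK.
pose m' : {sigma_finite_measure set (n.+1.-tuple R) -> \bar R} :=
  HB.pack (m : set _ -> _) (Measure.class m) (Measure_isSigmaFinite.Build _ _ _ m sfm).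
exists m' => g mg g0 /=.
have := ge0_integral_pushforward mcs (@lebesgue_measure R \x mu)%E measurableT mg (fun y _ => g0 y).
rewrite preimage_setT => ->.
have mgcs : measurable_fun setT (g \o cs) by exact: measurableT_comp.
rewrite fubini_tonelli1//; last by move=> p; exact: g0.
apply: eq_integral => x _; rewrite muE//.
  rewrite (_ : (fun v => _) = (g \o cs) \o pair x).
    by apply: measurableT_comp => //; exact: pair1_measurable.
  by apply/funext => v /=; congr g; exact: val_inj.
Qed.

(** Turns integrals against the joint density into expectations: by [is_densityN] the law of [X] has
    density [f] with respect to the measure just constructed. *)
Lemma lebesgue_integralN_density (d : measure_display) (T : measurableType d)
    (R : realType) (P : probability T R) (n : nat) (X : T -> n.-tuple R)
    (f : n.-tuple R -> R) (h : n.-tuple R -> R) :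
  is_densityN P X f -> measurable_fun setT h -> (forall v, 0 <= h v) ->
  lebesgue_integralN (fun v => (h v * f v)%:E) = (\int[P]_w (h (X w))%:E)%E.
Proof.
move=> [mX mf f0 PX] mh h0.
have [mu muE] := @ex_lebesgue_measureN R n.
have mEh : measurable_fun setT (EFin \o h) by exact/measurable_EFinP.
rewrite muE; last 2 first.
- by apply/measurable_EFinP; exact: measurable_funM.
- by move=> v; rewrite lee_fin mulr_ge0.
pose nu : {measure set (n.-tuple R) -> \bar R} :=
  measure_function_pushforward__canonical__measure_function_Measure P mX.
transitivity (\int[nu]_v (h v)%:E)%E; last first.
  have := ge0_integral_pushforward mX P measurableT mEh.
  by rewrite preimage_setT => -> // v _; rewrite lee_fin.
rewrite (@ge0_integral_density _ _ _ mu f mf f0 nu)//.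
move=> A mA; rewrite /nu/= /pushforward PX// muE.
- rewrite [RHS]integral_mkcond; apply: eq_integral => v _.
  by rewrite patchE indicE; case: ifPn => _; rewrite ?mul1r ?mul0r.
- by apply/measurable_EFinP; apply: measurable_funM => //; exact: measurable_indic.
- by move=> v; rewrite lee_fin mulr_ge0.
Qed.

(** * Independence and product laws *)

Section independence.
Context {d : measure_display} {T : measurableType d} {R : realType}.
Variable P : probability T R.

(** Factorisation on rectangles makes the joint law the product of the marginal laws; Tonelli then
    integrates [X] with [Y] frozen. *)
Lemma ge0_integral_indep (d1 d2 : measure_display) (T1 : measurableType d1)
    (T2 : measurableType d2) (X : T -> T1) (Y : T -> T2) (h : T1 * T2 -> \bar R) :
  measurable_fun setT X -> measurable_fun setT Y ->
  (forall A B, measurable A -> measurable B ->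
    P (X @^-1` A `&` Y @^-1` B) = (P (X @^-1` A) * P (Y @^-1` B))%E) ->
  measurable_fun setT h -> (forall p, 0 <= h p)%E ->
  (\int[P]_w h (X w, Y w) = \int[P]_w \int[P]_w' h (X w', Y w))%E.
Proof.
move=> mX mY XY mh h0.
pose X' : {mfun T >-> T1} := mfun_Sub (mem_set mX).
pose Y' : {mfun T >-> T2} := mfun_Sub (mem_set mY).
have mXY : measurable_fun setT (fun w => (X w, Y w)) by exact: measurable_fun_pair.
pose m : {measure set (T1 * T2)%type -> \bar R} :=
  measure_function_pushforward__canonical__measure_function_Measure P mXY.
have mE : forall A, measurable A -> (distribution P X' \x distribution P Y')%E A = m A.
  by apply: product_measure_unique => A B mA mB; exact: XY.
transitivity (\int[m]_p h p)%E.
  have := ge0_integral_pushforward mXY P measurableT mh (fun y _ => h0 y).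
  by rewrite preimage_setT => ->.
rewrite -(eq_measure_integral m (m1 := (distribution P X' \x distribution P Y')%E)); last first.
  by move=> A mA _; exact: mE.
rewrite fubini_tonelli2//.
rewrite (ge0_integral_pushforward mY P measurableT)//; last 2 first.
- exact: measurable_fun_fubini_tonelli_G.
- by move=> y _; apply: integral_ge0.
rewrite preimage_setT; apply: eq_integral => w _ /=; rewrite /fubini_G.
have mh' : measurable_fun setT (fun x => h (x, Y w)).
  by apply: measurableT_comp => //; exact: pair2_measurable.
rewrite (ge0_integral_pushforward mX P measurableT)//.
Qed.

Lemma is_density_integral (X : T -> R) (f : R -> R) (h : R -> \bar R) :
  is_density P X f -> measurable_fun setT h -> (forall x, 0 <= h x)%E ->
  (\int[P]_w h (X w) = \int[@lebesgue_measure R]_x (h x * (f x)%:E))%E.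
Proof.
move=> [mX mf f0 PX] mh h0.
have mX' : measurable_fun setT (X : T -> measurableTypeR R) by exact: mX.
pose nu : {measure set (measurableTypeR R) -> \bar R} :=
  measure_function_pushforward__canonical__measure_function_Measure P mX'.
rewrite -(@ge0_integral_density _ _ _ (@lebesgue_measure R) f mf f0 nu)//.
have := ge0_integral_pushforward mX' P measurableT mh (fun y _ => h0 y).
by rewrite preimage_setT => <-.
Qed.

(** For fixed [A], both sides are finite measures in [D] that agree on rectangles, a generating
    family stable under intersection. *)
Lemma indep_pair (d1 d2 d3 : measure_display) (T1 : measurableType d1)
    (T2 : measurableType d2) (T3 : measurableType d3)
    (X : T -> T1) (Y : T -> T2) (Z : T -> T3) :
  measurable_fun setT X -> measurable_fun setT Y -> measurable_fun setT Z ->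
  (forall A B C, measurable A -> measurable B -> measurable C ->
    P (X @^-1` A `&` Y @^-1` B `&` Z @^-1` C) =
      (P (X @^-1` A) * P (Y @^-1` B) * P (Z @^-1` C))%E) ->
  forall A D, measurable A -> measurable D ->
    P (X @^-1` A `&` (fun w => (Y w, Z w)) @^-1` D) =
      (P (X @^-1` A) * P ((fun w => (Y w, Z w)) @^-1` D))%E.
Proof.
move=> mX mY mZ XYZ A D mA mD.
have mE : measurable (X @^-1` A) by rewrite -[X in measurable X]setTI; exact: mX.
have mYZ : measurable_fun setT (fun w => (Y w, Z w)) by exact: measurable_fun_pair.
pose m1 : {measure set (T2 * T3)%type -> \bar R} :=
  measure_function_pushforward__canonical__measure_function_Measure (mrestr P mE) mYZ.
pose m2 : {measure set (T2 * T3)%type -> \bar R} :=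
  measure_function_pushforward__canonical__measure_function_Measure P mYZ.
have fE : P (X @^-1` A) \is a fin_num by exact: fin_num_measure.
have fE0 : 0 <= fine (P (X @^-1` A)) by exact: fine_ge0.
pose m3 := mscale (NngNum fE0) m2.
suff : m1 D = m3 D.
  by rewrite /m1 /m3 /m2/= /mscale/= /pushforward/= /mrestr/= fineK// setIC.
apply: (measure_unique [set B `*` C | B in measurable & C in measurable] (fun=> setT)) => //.
- exact: measurable_prod_measurableType.
- move=> _ _ [B mB [C mC <-]] [B' mB' [C' mC' <-]].
  rewrite -setXI; exists (B `&` B'); first exact: measurableI.
  by exists (C `&` C') => //; exact: measurableI.
- by move=> _; exists setT => //; exists setT => //; rewrite setXTT.
- by rewrite bigcup_const.
- move=> _ [B mB [C mC <-]].
  rewrite /m1 /m3 /m2/= /mscale/= /pushforward/= /mrestr/= fineK//.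
  have -> : (fun w => (Y w, Z w)) @^-1` (B `*` C) = Y @^-1` B `&` Z @^-1` C by [].
  rewrite setIC setIA XYZ//.
  (* Taking the first event to be everything extracts the independence of [Y] and [Z]. *)
  have := XYZ setT B C measurableT mB mC.
  by rewrite preimage_setT setTI probability_setT mul1e => ->; rewrite muleA.
- move=> k; rewrite /m1/= /pushforward/= /mrestr/=.
  by rewrite preimage_setT setTI ltey_eq fE.
Qed.
End independence.

(** * Lipschitz approximation of ray indicators *)

Section clamp.
Context {R : realType}.
Implicit Types a b x y : R.

Definition clamp a : R := Num.min 1 (Num.max 0 a).

Lemma clamp_ge0 a : 0 <= clamp a.
Proof. by rewrite /clamp le_min ler01 le_max lexx. Qed.

Lemma clamp_le0 a : a <= 0 -> clamp a = 0.
Proof. by move=> a0; rewrite /clamp max_l// min_r. Qed.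

Lemma clamp_ge1 a : 1 <= a -> clamp a = 1.
Proof. by move=> a1; rewrite /clamp max_r ?min_l// (le_trans ler01). Qed.

Lemma clamp_homo : {homo clamp : a b / a <= b}.
Proof. by move=> a b ab; rewrite /clamp le_min2// le_max2. Qed.

Lemma clamp_lip a b : clamp a <= clamp b + `|a - b|.
Proof.
have : a - b <= `|a - b| by exact: ler_norm.
have : 0 <= `|a - b| by exact: normr_ge0.
rewrite /clamp /Num.min /Num.max; set u := `|_|.
by do 4 case: ifPn; rewrite -?leNgt; lra.
Qed.

Lemma measurable_clamp : measurable_fun setT clamp.
Proof. by apply: measurable_minr => //; exact: measurable_maxr. Qed.

(** The sequence is eventually constant: it is 0 if [x <= c], and 1 as soon as [k] reaches
    [(x - c)^-1] otherwise. *)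
Lemma cvg_clamp_indic (x c : R) :
  (fun k : nat => (clamp (k%:R * (x - c)))%:E) @ \oo --> ((c < x)%R%:R)%:E.
Proof.
have [cx|xc] := ltP c x; last first.
  rewrite (_ : (fun k => _) = fun=> 0%E); first exact: cvg_cst.
  by apply/funext => k; rewrite clamp_le0// mulr_ge0_le0// subr_le0.
apply: cvg_near_cst; near=> k.
rewrite clamp_ge1// -ler_pdivrMr ?subr_gt0// div1r.
by near: k; exact: nbhs_infty_ger.
Unshelve. all: by end_near. Qed.

End clamp.

(** * Independence under limits in mean *)

Section independence_limit.
Context {d : measure_display} {T : measurableType d} {R : realType}.
Variable P : probability T R.

(** Under [P] restricted to [E], the law of [X] is [P E] times its law under [P]. *)
Lemma ge0_integral_indep_event (E : set T) (X : T -> R) (g : R -> R) :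
  measurable E -> measurable_fun setT X ->
  (forall C, measurable C -> P (E `&` X @^-1` C) = (P E * P (X @^-1` C))%E) ->
  measurable_fun setT g -> (forall x, 0 <= g x) ->
  (\int[P]_(w in E) (g (X w))%:E = P E * \int[P]_w (g (X w))%:E)%E.
Proof.
move=> mE mX EX mg g0.
have mgX : measurable_fun setT (fun w => g (X w)) by exact: measurableT_comp.
have mEgX : measurable_fun setT (fun w => (g (X w))%:E) by exact/measurable_EFinP.
have mEg : measurable_fun setT (EFin \o g) by exact/measurable_EFinP.
have Eg0 x : (0 <= (EFin \o g) x)%E by rewrite lee_fin.
have mI : measurable_fun setT (\1_E : T -> R) by exact: measurable_indic.
pose Q : {measure set T -> \bar R} := mrestr P mE.
pose m1 : {measure set R -> \bar R} :=
  measure_function_pushforward__canonical__measure_function_Measure Q mX.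
pose m2 : {measure set R -> \bar R} :=
  measure_function_pushforward__canonical__measure_function_Measure P mX.
have PE0 : 0 <= fine (P E) by exact: fine_ge0.
have PEfin : P E \is a fin_num by exact: fin_num_measure.
pose m3 := mscale (NngNum PE0) m2.
transitivity (\int[Q]_w (g (X w))%:E)%E.
  rewrite (@ge0_integral_density _ _ _ P (\1_E) mI _ Q)//.
  - rewrite [LHS]integral_mkcond; apply: eq_integral => w _.
    by rewrite patchE indicE; case: ifPn => _; rewrite ?mule1 ?mule0.
  - by move=> A mA; rewrite /Q/= /mrestr integral_indic// setIC.
  - by move=> w; rewrite lee_fin.
transitivity (\int[m1]_x (g x)%:E)%E.
  have := ge0_integral_pushforward mX Q measurableT mEg (fun y _ => Eg0 y).
  by rewrite preimage_setT => ->.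
rewrite (eq_measure_integral m3); last first.
  move=> C mC _; rewrite /m1 /m3 /m2/= /mscale/= /pushforward/= /mrestr/= fineK//.
  by rewrite setIC EX.
rewrite ge0_integral_mscale//; last by move=> x _; rewrite lee_fin.
rewrite -[in RHS](fineK PEfin); congr (_ * _)%E.
have := ge0_integral_pushforward mX P measurableT mEg (fun y _ => Eg0 y).
by rewrite preimage_setT => ->.
Qed.

(* Testing against the [k]-Lipschitz functions [clamp (k * (_ - c))], which
   increase to the indicator of [c < x] as [k] grows. *)
Lemma indep_event_cvgL1 (E : set T) (V : T -> R) (W : nat -> T -> R) :
  measurable E -> measurable_fun setT V -> (forall n, measurable_fun setT (W n)) ->
  (\forall n \near \oo, forall C, measurable C ->
    P (E `&` W n @^-1` C) = (P E * P (W n @^-1` C))%E) ->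
  (forall e, 0 < e ->
    \forall n \near \oo, (\int[P]_w (`|W n w - V w|)%:E <= e%:E)%E) ->
  forall C, measurable C -> P (E `&` V @^-1` C) = (P E * P (V @^-1` C))%E.
Proof.
move=> mE mV mW EW L1 C mC.
have PEfin : P E \is a fin_num by exact: fin_num_measure.
pose phi (c : R) (k : nat) x := clamp (k%:R * (x - c)).
have mphi c k : measurable_fun setT (phi c k).
  apply: measurableT_comp; first exact: measurable_clamp.
  by apply: measurable_funM => //; exact: measurable_funB.
have mphiX c k (X : T -> R) : measurable_fun setT X ->
    measurable_fun setT (fun w => (phi c k (X w))%:E).
  by move=> mX; apply/measurable_EFinP; exact: measurableT_comp.
have phi0 c k (x : R) : (0 <= (phi c k x)%:E)%E by rewrite lee_fin clamp_ge0.
(* [phi c k] is [k]-Lipschitz, so on any event exchanging [X] and [Y] costs at most [k] times their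
   mean distance. *)
have lip (D : set T) c k (X Y : T -> R) : measurable D ->
    measurable_fun setT X -> measurable_fun setT Y ->
    (\int[P]_(w in D) (phi c k (X w))%:E <= \int[P]_(w in D) (phi c k (Y w))%:E +
      k%:R%:E * \int[P]_w (`|X w - Y w|)%:E)%E.
  move=> mD mX mY.
  have mXY : measurable_fun setT (fun w => `|X w - Y w|).
    by apply: measurableT_comp => //; exact: measurable_funB.
  rewrite -ge0_integralZl//; last exact/measurable_EFinP.
  apply: (@le_trans _ _ (\int[P]_(w in D) (phi c k (Y w))%:E +
      \int[P]_(w in D) (k%:R%:E * (`|X w - Y w|)%:E))%E); last first.
    rewrite leeD2l//; apply: ge0_subset_integral => //.
      by apply: measurable_funeM; exact/measurable_EFinP.
  rewrite -ge0_integralD//; last 2 first.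
    exact/measurable_funTS/mphiX.
    by apply: measurable_funTS; apply: measurable_funeM; exact/measurable_EFinP.
  apply: ge0_le_integral => //.
  - exact/measurable_funTS/mphiX.
  - apply: emeasurable_funD; first exact/measurable_funTS/mphiX.
    by apply: measurable_funTS; apply: measurable_funeM; exact/measurable_EFinP.
  - move=> w _; rewrite -EFinM -EFinD lee_fin (le_trans (clamp_lip _ (k%:R * (Y w - c))))//.
    rewrite lerD2l -mulrBr (_ : X w - c - (Y w - c) = X w - Y w); last by ring.
    by rewrite normrM ger0_norm.
have key c k : (\int[P]_(w in E) (phi c k (V w))%:E =
    P E * \int[P]_w (phi c k (V w))%:E)%E.
  have PE1 : (P E <= 1)%E by exact: probability_le1.
  suff H : forall e, 0 < e ->
      ((\int[P]_(w in E) (phi c k (V w))%:E <=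
        P E * \int[P]_w (phi c k (V w))%:E + e%:E)%E /\
       (P E * \int[P]_w (phi c k (V w))%:E <=
        \int[P]_(w in E) (phi c k (V w))%:E + e%:E)%E).
    apply/eqP; rewrite eq_le; apply/andP; split; apply/lee_addgt0Pr => e /H[].
      by [].
    by [].
  move=> e e0.
  (* Each inequality replaces [V] by [W N] and back, and each replacement costs at most
     [k * eta <= e / 2]. Dividing by [k.+1] covers [k = 0]. *)
  pose eta := e / 2 / k.+1%:R.
  have eta0 : 0 < eta by rewrite !divr_gt0.
  near \oo => N.
  have EWN : forall C, measurable C -> P (E `&` W N @^-1` C) = (P E * P (W N @^-1` C))%E.
    by near: N.
  have L1N : (\int[P]_w (`|W N w - V w|)%:E <= eta%:E)%E by near: N; exact: L1.
  have EWphi := ge0_integral_indep_event mE (mW N) EWN (mphi c k) (fun x => clamp_ge0 _).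
  pose a := (k%:R%:E * \int[P]_w (`|W N w - V w|)%:E)%E.
  have a0 : (0 <= a)%E.
    by rewrite mule_ge0 ?lee_fin//; apply: integral_ge0 => w _; rewrite lee_fin.
  have ae : (a + a <= e%:E)%E.
    rewrite (splitr e) EFinD.
    have : (a <= (e / 2)%:E)%E.
      rewrite (le_trans (lee_wpmul2l _ L1N)) ?lee_fin// /eta.
      rewrite mulrCA ler_piMr ?divr_ge0 ?ltW//.
      by rewrite ltr_pdivrMr// mul1r ltr_nat.
    by move=> ae; exact: leeD.
  have lipW D mD := @lip D c k _ _ mD (mW N) mV.
  have lipV D mD : (_ <= _)%E := @lip D c k _ _ mD mV (mW N).
  have distVW : (\int[P]_w (`|V w - W N w|)%:E = \int[P]_w (`|W N w - V w|)%:E)%E.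
    by apply: eq_integral => w _; rewrite distrC.
  have PEa : (P E * a <= a)%E by rewrite -[leRHS]mul1e lee_wpmul2r.
  have I0 D X : (0 <= \int[P]_(w in D) (phi c k (X w))%:E)%E.
    by apply: integral_ge0.
  split.
    rewrite (le_trans (lipV E mE))// distVW -/a EWphi.
    rewrite (@le_trans _ _ (P E * (\int[P]_w (phi c k (V w))%:E + a) + a)%E)//.
      by rewrite leeD2r// lee_wpmul2l// lipW.
    rewrite ge0_muleDr// -addeA leeD2l//.
    by rewrite (le_trans _ ae)// leeD2r.
  rewrite (@le_trans _ _ (P E * (\int[P]_w (phi c k (W N w))%:E + a))%E)//.
    by rewrite lee_wpmul2l// /a -distVW lipV.
  rewrite ge0_muleDr// -EWphi.
  rewrite (@le_trans _ _ (\int[P]_(w in E) (phi c k (V w))%:E + a + a)%E)//.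
    by rewrite leeD// lipW.
  by rewrite -addeA leeD2l.
have ray c : P (E `&` V @^-1` `]c, +oo[) = (P E * P (V @^-1` `]c, +oo[))%E.
  have mr : measurable (V @^-1` `]c, +oo[) by rewrite -[X in measurable X]setTI; exact: mV.
  have lim D : measurable D ->
      ((fun k => \int[P]_(w in D) (phi c k (V w))%:E) @ \oo --> P (D `&` V @^-1` `]c, +oo[))%E.
    move=> mD.
    have -> : P (D `&` V @^-1` `]c, +oo[) =
        (\int[P]_(w in D) limn (fun k => (phi c k (V w))%:E))%E.
      rewrite setIC -integral_indic//; apply: eq_integral => w _.
      rewrite indicE; apply/esym/cvg_lim => //.
      have -> : (w \in V @^-1` `]c, +oo[) = (c < V w).
        by apply/idP/idP; rewrite inE/= in_itv/= andbT.
      exact: cvg_clamp_indic.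
    apply: cvg_monotone_convergence => //.
    - by move=> k; exact/measurable_funTS/mphiX.
    - move=> w _ k l kl; rewrite lee_fin.
      have [Vc|cV] := leP (V w) c.
        by rewrite /phi clamp_le0 ?clamp_ge0// mulr_ge0_le0// subr_le0.
      by apply: clamp_homo; rewrite ler_wpM2r ?ler_nat// subr_ge0 ltW.
  have l1 := lim E mE.
  have l2 : ((fun k => P E * \int[P]_w (phi c k (V w))%:E) @ \oo -->
      P E * P (V @^-1` `]c, +oo[))%E.
    by apply: cvgeZl => //; have := lim setT measurableT; rewrite setTI.
  apply: (cvg_unique (@ereal_hausdorff R) l1).
  by rewrite (_ : (fun k => _) = fun k => P E * \int[P]_w (phi c k (V w))%:E)%E//;
    apply/funext => k.
have mV' : measurable_fun setT (V : T -> measurableTypeR R) by exact: mV.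
pose Q : {measure set T -> \bar R} := mrestr P mE.
pose m1 : {measure set (measurableTypeR R) -> \bar R} :=
  measure_function_pushforward__canonical__measure_function_Measure Q mV'.
pose m2 : {measure set (measurableTypeR R) -> \bar R} :=
  measure_function_pushforward__canonical__measure_function_Measure P mV'.
have PE0 : 0 <= fine (P E) by exact: fine_ge0.
pose m3 : {measure set (measurableTypeR R) -> \bar R} := mscale (NngNum PE0) m2.
(* Open rays are stable under intersection and generate the Borel sets, so finite measures agreeing
   on them coincide. *)
suff : m1 C = m3 C.
  by rewrite /m1 /m3 /m2/= /mscale/= /pushforward/= /mrestr/= fineK// setIC.
apply: (@measure_unique _ R (measurableTypeR R) (@RGenOInfty.G R)
  (fun k => `](- k%:R), +oo[%classic) _ _ _ _ m1 m3) => //.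
- exact: (RGenOInfty.measurableE R).
- move=> _ _ [x ->] [y ->]; exists (Num.max x y).
  by apply/seteqP; split=> z /=; rewrite !in_itv/= !andbT gt_max; [case=> -> ->|case/andP].
- by move=> k; exists (- k%:R).
- apply/seteqP; split=> // z _; have := truncnS_gt (- z) => zn.
  by exists (Num.truncn (- z)).+1 => //=; rewrite in_itv/= andbT ltrNl.
- move=> _ [x ->]; rewrite /m1 /m3 /m2/= /mscale/= /pushforward/= /mrestr/= fineK//.
  by rewrite setIC ray.
- move=> k; rewrite /m1/= /pushforward/= /mrestr/=.
  rewrite (@le_lt_trans _ _ 1%E) ?ltry// probability_le1//; apply: measurableI => //.
  by rewrite -[X in measurable X]setTI; exact: mV.
Unshelve. all: by end_near. Qed.

End independence_limit.

(** * Density of an affine image plus an independent term *)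

Section affine_density.
Context {d : measure_display} {T : measurableType d} {R : realType}.
Variables (P : probability T R) (U : T -> R) (f : R -> R) (c m : R).
Hypothesis dU : is_density P U f.
Hypothesis c0 : c != 0.
Local Notation mu := (@lebesgue_measure R).

Let mU : measurable_fun setT U. Proof. by case: dU. Qed.
Let mf : measurable_fun setT f. Proof. by case: dU. Qed.
Let f0 x : 0 <= f x. Proof. by case: dU. Qed.

(* density at [v] of [m + c * U + Z] for [Z] independent of [U] *)
Definition affine_density (Z : T -> R) (v : R) : \bar R :=
  (\int[P]_w (f ((v - m - Z w) / c) / `|c|)%:E)%E.

Let measurable_affine_kernel (Z : T -> R) : measurable_fun setT Z ->
  measurable_fun setT (fun p : measurableTypeR R * T => (f ((p.1 - m - Z p.2) / c) / `|c|)%:E).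
Proof.
move=> mZ; apply/measurable_EFinP; apply: measurable_funM => //.
apply: measurableT_comp => //; apply: measurable_funM => //.
apply: measurable_funB; first by apply: measurable_funB => //; exact: measurable_fst.
by apply: measurableT_comp => //; exact: measurable_snd.
Qed.

Let affine_kernel_ge0 (z v : R) : (0 <= (f ((v - m - z) / c) / `|c|)%:E)%E.
Proof. by rewrite lee_fin divr_ge0. Qed.

Lemma affine_density_ge0 Z v : (0 <= affine_density Z v)%E.
Proof. exact: integral_ge0. Qed.

Lemma measurable_affine_density Z : measurable_fun setT Z ->
  measurable_fun setT (affine_density Z).
Proof.
move=> mZ.
exact: (measurable_fun_fubini_tonelli_F _ (measurable_affine_kernel mZ)).
Qed.

(** Independence freezes [Z], the substitution [v = m + c * u + Z w] moves the integral against [f]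
    to the variable [v], and Tonelli exchanges the two integrals. *)
Lemma affine_densityP (Z : T -> R) (h : R -> \bar R) : measurable_fun setT Z ->
  (forall A B, measurable A -> measurable B ->
    P (U @^-1` A `&` Z @^-1` B) = (P (U @^-1` A) * P (Z @^-1` B))%E) ->
  measurable_fun setT h -> (forall v, 0 <= h v)%E ->
  (\int[P]_w h (m + c * U w + Z w)%R = \int[mu]_v (h v * affine_density Z v))%E.
Proof.
move=> mZ UZ mh h0.
have mhh : measurable_fun setT (fun p : R * R => h (m + c * p.1 + p.2)).
  apply: measurableT_comp => //; apply: measurable_funD => //.
  by apply: measurable_funD => //; exact: measurable_funM.
rewrite (ge0_integral_indep mU mZ UZ mhh)//=.
transitivity (\int[P]_w \int[mu]_v (h v * (f ((v - m - Z w) / c) / `|c|)%:E))%E.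
  apply: eq_integral => w _.
  have mhw : measurable_fun setT (fun u => h (m + c * u + Z w)).
    apply: measurableT_comp => //; apply: measurable_funD => //.
    by apply: measurable_funD => //; exact: measurable_funM.
  rewrite (is_density_integral dU mhw)//.
  rewrite -(@ge0_integral_affine _ c (m + Z w)
    (fun v => h v * (f ((v - m - Z w) / c) / `|c|)%:E)%E)//; last 2 first.
  - apply: emeasurable_funM => //; apply/measurable_EFinP.
    apply: measurable_funM => //; apply: measurableT_comp => //.
    by apply: measurable_funM => //; do 2 apply: measurable_funB => //.
  - by move=> v; rewrite mule_ge0.
  apply: eq_integral => u _; rewrite -muleA -EFinM mulfVK ?normr_eq0//.
  congr (h _ * (f _)%:E)%E; first by ring.
  by field.
rewrite -(@fubini_tonelli _ _ _ _ _ mu P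
   (fun p => h p.1 * (f ((p.1 - m - Z p.2) / c) / `|c|)%:E)%E)//; last 2 first.
- apply: emeasurable_funM; last exact: measurable_affine_kernel.
  exact: (measurableT_comp mh measurable_fst).
- by move=> p; rewrite mule_ge0.
apply: eq_integral => v _; rewrite /= ge0_integralZl//.
exact: (measurableT_comp (measurable_affine_kernel mZ) (pair1_measurable v)).
Qed.

(** One factor [1 / |c|] comes from the argument of [f], the other from the normalisation of the
    density. The one-sided form avoids subtracting extended reals; exchanging [Z] and [Z'] gives the
    other side. *)
Lemma affine_density_lip (L : R) (Z Z' : T -> R) (v : R) : 0 <= L ->
  (forall y z, `|f y - f z| <= L * `|y - z|) ->
  measurable_fun setT Z -> measurable_fun setT Z' ->
  (affine_density Z v <= affine_density Z' v +
    (L / c ^+ 2)%:E * \int[P]_w (`|Z w - Z' w|)%:E)%E.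
Proof.
move=> L0 fL mZ mZ'.
have mZZ : measurable_fun setT (fun w => (`|Z w - Z' w|)%:E).
  by apply/measurable_EFinP; apply: measurableT_comp => //; exact: measurable_funB.
have mk (X : T -> R) : measurable_fun setT X ->
    measurable_fun setT (fun w : T => (f ((v - m - X w) / c) / `|c|)%:E).
  move=> mX.
  exact: (measurableT_comp (measurable_affine_kernel mX) (pair1_measurable (v : measurableTypeR R))).
have Lc0 : 0 <= L / c ^+ 2 by rewrite divr_ge0// sqr_ge0.
rewrite -ge0_integralZl// -ge0_integralD//; last 3 first.
- exact: mk.
- by move=> w _; rewrite mule_ge0 ?lee_fin.
- exact: measurable_funeM.
apply: ge0_le_integral => //.
- exact: mk.
- by apply: emeasurable_funD; [exact: mk|exact: measurable_funeM].
move=> w _; rewrite -EFinM -EFinD lee_fin.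
have : f ((v - m - Z w) / c) - f ((v - m - Z' w) / c) <= L * (`|Z w - Z' w| / `|c|).
  rewrite (le_trans (ler_norm _))// (le_trans (fL _ _))//.
  rewrite -mulrBl normrM normfV (_ : v - m - Z w - (v - m - Z' w) = - (Z w - Z' w)) ?normrN//.
  by ring.
have ci0 : 0 <= `|c|^-1 by rewrite invr_ge0.
move=> /(ler_wpM2r ci0); rewrite mulrBl lerBlDl => fZ.
apply: (le_trans fZ); rewrite lerD2l.
rewrite (_ : c ^+ 2 = `|c| ^+ 2); last by rewrite real_normK ?num_real.
by rewrite expr2 invfM; lra.
Qed.

End affine_density.

(** * Density of a product with an independent exponential factor *)

Section product_density.
Context {d : measure_display} {T : measurableType d} {R : realType}.
Variables (P : probability T R) (x0 : T -> R) (f0 : R -> R).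
Hypothesis dx0 : is_density P x0 f0.
Local Notation mu := (@lebesgue_measure R).

Let mx0 : measurable_fun setT x0. Proof. by case: dx0. Qed.
Let mf0 : measurable_fun setT f0. Proof. by case: dx0. Qed.
Let f00 x : 0 <= f0 x. Proof. by case: dx0. Qed.

(** For constant [v], this is the density at [y] of [x0 * expR v]. *)
Definition dilate (y v : R) : R := f0 (y * expR (- v)) * expR (- v).

Lemma dilate_ge0 y v : 0 <= dilate y v.
Proof. by rewrite mulr_ge0 ?expR_ge0. Qed.

Lemma measurable_dilate (d' : measure_display) (T' : measurableType d')
    (f g : T' -> R) : measurable_fun setT f -> measurable_fun setT g ->
  measurable_fun setT (fun x => dilate (f x) (g x)).
Proof.
move=> mf mg.
have me : measurable_fun setT (fun x => expR (- g x)).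
  by apply: measurableT_comp => //; exact: measurableT_comp.
by apply: measurable_funM => //; apply: measurableT_comp => //; exact: measurable_funM.
Qed.

(* density at [y] of [x0 * expR V] for [V] independent of [x0] *)
Definition product_density (V : T -> R) (y : R) : \bar R :=
  (\int[P]_w (dilate y (V w))%:E)%E.

Lemma product_density_ge0 V y : (0 <= product_density V y)%E.
Proof. by apply: integral_ge0 => w _; rewrite lee_fin dilate_ge0. Qed.

Let measurable_dilate_pair (V : T -> R) : measurable_fun setT V ->
  measurable_fun setT (fun p : measurableTypeR R * T => (dilate p.1 (V p.2))%:E).
Proof.
move=> mV; apply/measurable_EFinP; apply: measurable_dilate.
  exact: measurable_fst.
by apply: measurableT_comp => //; exact: measurable_snd.
Qed.

Lemma measurable_product_density V : measurable_fun setT V ->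
  measurable_fun setT (product_density V).
Proof.
move=> mV; apply: (measurable_fun_fubini_tonelli_F _ (measurable_dilate_pair mV)).
by move=> p; rewrite lee_fin dilate_ge0.
Qed.

(** Independence freezes [V], the dilation [y = x * expR (V w)] turns [f0] into [dilate], and
    Tonelli exchanges the integrals. *)
Lemma product_densityP (V : T -> R) (A : set R) : measurable_fun setT V ->
  (forall A B, measurable A -> measurable B ->
    P (x0 @^-1` A `&` V @^-1` B) = (P (x0 @^-1` A) * P (V @^-1` B))%E) ->
  measurable A ->
  P ((fun w => x0 w * expR (V w)) @^-1` A) = (\int[mu]_(y in A) product_density V y)%E.
Proof.
move=> mV x0V mA.
have mIA : measurable_fun setT (\1_A : R -> R) by exact: measurable_indic.
have meV : measurable_fun setT (fun w => expR (V w)) by exact: measurableT_comp.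
have mprod : measurable_fun setT (fun w => x0 w * expR (V w)) by exact: measurable_funM.
transitivity (\int[P]_w ((\1_A (x0 w * expR (V w)) : R))%:E)%E.
  rewrite (_ : (fun w => _) =
      fun w => (\1_((fun w => x0 w * expR (V w)) @^-1` A) w)%:E)//.
  by rewrite integral_indic ?setIT// -[X in measurable X]setTI; exact: mprod.
have mh : measurable_fun setT (fun p : R * R => ((\1_A (p.1 * expR p.2) : R))%:E).
  apply/measurable_EFinP; apply: measurableT_comp => //.
  by apply: measurable_funM => //; exact: measurableT_comp.
rewrite (ge0_integral_indep mx0 mV x0V mh)//=.
transitivity (\int[P]_w \int[mu]_y ((\1_A y * dilate y (V w))%:E))%E.
  apply: eq_integral => w _.
  have mhw : measurable_fun setT (fun x : R => ((\1_A (x * expR (V w)) : R))%:E).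
    apply/measurable_EFinP; apply: measurableT_comp => //.
    exact: measurable_funM.
  rewrite (is_density_integral dx0 mhw)//.
  rewrite -(@ge0_integral_affine _ (expR (V w)) 0
    (fun y => ((\1_A y * dilate y (V w)))%:E)); last 3 first.
  - by rewrite gt_eqF ?expR_gt0.
  - apply/measurable_EFinP; apply: measurable_funM => //.
    exact: measurable_dilate.
  - by move=> y; rewrite lee_fin mulr_ge0// dilate_ge0.
  apply: eq_integral => y _; rewrite addr0 -!EFinM; congr EFin.
  rewrite /dilate (mulrC (expR _) y) -(mulrA y) -expRD subrr expR0 mulr1.
  by rewrite gtr0_norm ?expR_gt0// -!mulrA -expRD addNr expR0 mulr1.
rewrite -(@fubini_tonelli _ _ _ _ _ mu P
   (fun p => (\1_A p.1 * dilate p.1 (V p.2))%:E)); last 2 first.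
- apply/measurable_EFinP; apply: measurable_funM.
    exact: (measurableT_comp mIA measurable_fst).
  by apply/measurable_EFinP; exact: measurable_dilate_pair.
- by move=> p; rewrite lee_fin mulr_ge0// dilate_ge0.
rewrite [RHS]integral_mkcond; apply: eq_integral => y _ /=.
rewrite patchE indicE; case: ifPn => _; last first.
  by under eq_integral do rewrite mul0r; rewrite integral0.
by under eq_integral do rewrite mul1r.
Qed.

(** The extended-real density has total mass 1, hence is finite almost everywhere, and [fine] alters
    it only on a null set. *)
Lemma is_density_product_density (V : T -> R) : measurable_fun setT V ->
  (forall A B, measurable A -> measurable B ->
    P (x0 @^-1` A `&` V @^-1` B) = (P (x0 @^-1` A) * P (V @^-1` B))%E) ->
  is_density P (fun w => x0 w * expR (V w)) (fine \o product_density V) /\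
  {ae mu, forall y, product_density V y \is a fin_num}.
Proof.
move=> mV x0V.
have mF := measurable_product_density mV.
have F0 := product_density_ge0 V.
have iF : mu.-integrable setT (product_density V).
  apply/integrableP; split => //.
  under eq_integral do rewrite gee0_abs//.
  by rewrite -product_densityP// preimage_setT probability_setT ltry.
have Ffin : {ae mu, forall y, product_density V y \is a fin_num}.
  have := integrable_ae measurableT iF.
  by apply: filterS => y; exact.
split=> //; split.
- by apply: measurable_funM => //; exact: measurableT_comp.
- exact: measurableT_comp.
- by move=> y /=; rewrite fine_ge0.
move=> A mA; rewrite product_densityP//; apply: ae_eq_integral => //.
- exact: measurable_funTS.
- by apply/measurable_EFinP/measurable_funTS; exact: measurableT_comp.
- have [N [mN N0 FN]] := Ffin; exists N; split => // y; apply: contra_notP => Ny _ /=.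
  by rewrite fineK//; apply: contrapT => Fy; exact: Ny (FN _ Fy).
Qed.

End product_density.

(** * Lipschitz dependence of the product density on the perturbation *)

Section uniform_limit.
Context {d : measure_display} {T : measurableType d} {R : realType}.
Variables (P : probability T R) (x0 U : T -> R) (f0 f : R -> R) (c m L : R).
Hypothesis dx0 : is_density P x0 f0.
Hypothesis dU : is_density P U f.
Hypothesis c0 : c != 0.
Hypothesis fL : forall y z, `|f y - f z| <= L * `|y - z|.
Local Notation mu := (@lebesgue_measure R).

Let indep2 (X Y : T -> R) := forall A B, measurable A -> measurable B ->
  P (X @^-1` A `&` Y @^-1` B) = (P (X @^-1` A) * P (Y @^-1` B))%E.

(** Both densities are integrals of [dilate f0 y] against affine densities, whose pointwise gap is
    controlled by [affine_density_lip]; the remaining integral of [dilate f0 y] is at most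
    [1 / |y|]. *)
Lemma product_density_lip (Z Z' : T -> R) (y : R) : y != 0 ->
  measurable_fun setT Z -> measurable_fun setT Z' -> indep2 U Z -> indep2 U Z' ->
  (product_density P f0 (fun w => m + c * U w + Z w)%R y <=
   product_density P f0 (fun w => m + c * U w + Z' w)%R y +
   (`|L| / c ^+ 2 / `|y|)%:E * \int[P]_w (`|Z w - Z' w|)%:E)%E.
Proof.
move=> y0 mZ mZ' UZ UZ'.
have [_ mf0 f00 Pf0] := dx0.
have mD : measurable_fun setT (fun v => (dilate f0 y v)%:E).
  by apply/measurable_EFinP; exact: (measurable_dilate dx0).
have D0 v : (0 <= (dilate f0 y v)%:E)%E by rewrite lee_fin (dilate_ge0 dx0).
have q0 X v := affine_density_ge0 c m dU X v.
have mq X mX := @measurable_affine_density _ _ _ P U f c m dU X mX.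
rewrite /product_density (affine_densityP m dU c0 mZ UZ mD)// (affine_densityP m dU c0 mZ' UZ' mD)//.
set k := (\int[P]_w _)%E.
have k0 : (0 <= k)%E by apply: integral_ge0 => w _; rewrite lee_fin.
have L0 : 0 <= `|L| / c ^+ 2 by rewrite divr_ge0// sqr_ge0.
(* Passing to [|L|] gives a nonnegative constant without arguing about the sign of [L]. *)
have fL' u z : `|f u - f z| <= `|L| * `|u - z|.
  by rewrite (le_trans (fL u z))// ler_wpM2r// ler_norm.
apply: (@le_trans _ _ (\int[mu]_v ((dilate f0 y v)%:E * affine_density P f c m Z' v +
   (dilate f0 y v)%:E * ((`|L| / c ^+ 2)%:E * k)))%E).
  apply: ge0_le_integral => //.
  - by move=> v _; rewrite mule_ge0.
  - by apply: emeasurable_funM => //; exact: mq.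
  - apply: emeasurable_funD.
      by apply: emeasurable_funM => //; exact: mq.
    exact: emeasurable_funM.
  - move=> v _; rewrite -ge0_muleDr//; last by rewrite mule_ge0 ?lee_fin.
    by rewrite lee_wpmul2l//; exact: (affine_density_lip _ _ dU).
rewrite ge0_integralD//; last 4 first.
- by move=> v _; rewrite mule_ge0.
- by apply: emeasurable_funM => //; exact: mq.
- by move=> v _; rewrite mule_ge0// mule_ge0 ?lee_fin.
- exact: emeasurable_funM.
rewrite leeD2l// ge0_integralZr//; last by rewrite mule_ge0 ?lee_fin.
rewrite (_ : (`|L| / c ^+ 2 / `|y|)%:E = `|y|^-1%:E * (`|L| / c ^+ 2)%:E)%E; last first.
  by rewrite -EFinM mulrC.
rewrite -muleA lee_wpmul2r ?mule_ge0 ?lee_fin//.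
have := le_integral_dilation y0 mf0 f00.
by rewrite -Pf0// preimage_setT probability_setT mule1.
Qed.

End uniform_limit.

(** * Uniform convergence of densities away from zero *)

Section uniform_convergence.
Context {d : measure_display} {T : measurableType d} {R : realType}.
Variables (P : probability T R) (x0 U : T -> R) (f0 f : R -> R) (c m L : R).
Hypothesis dx0 : is_density P x0 f0.
Hypothesis dU : is_density P U f.
Hypothesis c0 : c != 0.
Hypothesis fL : forall y z, `|f y - f z| <= L * `|y - z|.
Variables (Z : T -> R) (ZN : nat -> T -> R).
Hypothesis mZ : measurable_fun setT Z.
Hypothesis mZN : forall N, measurable_fun setT (ZN N).
Hypothesis indepN : \forall N \near \oo, forall A B C,
  measurable A -> measurable B -> measurable C ->
  P (x0 @^-1` A `&` U @^-1` B `&` ZN N @^-1` C) =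
    (P (x0 @^-1` A) * P (U @^-1` B) * P (ZN N @^-1` C))%E.
Hypothesis L1 : forall e, 0 < e ->
  \forall N \near \oo, (\int[P]_w (`|ZN N w - Z w|)%:E <= e%:E)%E.
Local Notation mu := (@lebesgue_measure R).

Lemma product_density_cvg : exists f1 : R -> R,
  is_density P (fun w => x0 w * expR (m + c * U w + Z w)) f1 /\
  forall delta e : R, 0 < delta -> 0 < e -> \forall N \near \oo,
    {ae mu, forall y, delta < `|y| ->
      (`| product_density P f0 (fun w => m + c * U w + ZN N w)%R y - (f1 y)%:E |
        <= e%:E)%E}.
Proof.
have mx0 : measurable_fun setT x0 by case: dx0.
have mU : measurable_fun setT U by case: dU.
have mpre (X : T -> R) A : measurable_fun setT X -> measurable A -> measurable (X @^-1` A).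
  by move=> mX mA; rewrite -[X in measurable X]setTI; exact: mX.
have UZN : \forall N \near \oo, forall A B, measurable A -> measurable B ->
    P (U @^-1` A `&` ZN N @^-1` B) = (P (U @^-1` A) * P (ZN N @^-1` B))%E.
  move: indepN; apply: filterS => N H A B mA mB.
  by have := H setT A B measurableT mA mB; rewrite preimage_setT setTI probability_setT mul1e.
have UZ A B : measurable A -> measurable B ->
    P (U @^-1` A `&` Z @^-1` B) = (P (U @^-1` A) * P (Z @^-1` B))%E.
  move=> mA mB; apply: (@indep_event_cvgL1 _ _ _ P _ Z ZN) => //; first exact: mpre.
  by move: UZN; apply: filterS => N H C mC; exact: H.
pose V w := m + c * U w + Z w; pose VN N w := m + c * U w + ZN N w.
have maff (X : T -> R) : measurable_fun setT X ->
    measurable_fun setT (fun w => m + c * U w + X w).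
  move=> mX; apply: measurable_funD => //; apply: measurable_funD => //.
  exact: measurable_funM.
(* [x0] is independent of the pair of [U] and [ZN N], hence of [VN N]; moreover
   [VN N - V = ZN N - Z] tends to 0 in mean. *)
have x0V A B : measurable A -> measurable B ->
    P (x0 @^-1` A `&` V @^-1` B) = (P (x0 @^-1` A) * P (V @^-1` B))%E.
  move=> mA mB; apply: (@indep_event_cvgL1 _ _ _ P _ V VN) => //.
  - exact: mpre.
  - exact: maff.
  - by move=> N; exact: maff.
  - move: indepN; apply: filterS => N H C mC.
    have := indep_pair mx0 mU (mZN N) H mA
      (D := (fun p : R * R => m + c * p.1 + p.2) @^-1` C).
    apply; rewrite -[X in measurable X]setTI.
    apply: (_ : measurable_fun setT (fun p : R * R => m + c * p.1 + p.2)) => //.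
    apply: measurable_funD => //.
    by apply: measurable_funD => //; exact: measurable_funM.
  - move=> e e0; have := L1 e0; apply: filterS => N.
    rewrite (_ : (\int[P]_w `|VN N w - V w|%:E = \int[P]_w (`|ZN N w - Z w|)%:E)%E)//.
    by apply: eq_integral => w _; congr (`| _ |%:E); rewrite /VN /V; ring.
have [dF Ffin] := is_density_product_density dx0 (maff _ mZ) x0V.
exists (fine \o product_density P f0 V); split => // delta e delta0 e0.
(* [K] bounds the factor of [product_density_lip] for all [|y| > delta]. The tolerance [e / (K + 1)]
   makes sense even when [K = 0]. *)
pose K := `|L| / c ^+ 2 / delta.
have K0 : 0 <= K by rewrite !divr_ge0 ?sqr_ge0// ltW.
have eta0 : 0 < e / (K + 1) by rewrite divr_gt0// ltr_wpDl.
near=> N.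
have UZNN : forall A B, measurable A -> measurable B ->
    P (U @^-1` A `&` ZN N @^-1` B) = (P (U @^-1` A) * P (ZN N @^-1` B))%E.
  by near: N.
have L1N : (\int[P]_w (`|ZN N w - Z w|)%:E <= (e / (K + 1))%:E)%E.
  by near: N; exact: L1.
have L1N' : (\int[P]_w (`|Z w - ZN N w|)%:E <= (e / (K + 1))%:E)%E.
  by under eq_integral do rewrite distrC.
have bound (k : \bar R) (y : R) : delta < `|y| -> (0 <= k)%E -> (k <= (e / (K + 1))%:E)%E ->
    ((`|L| / c ^+ 2 / `|y|)%:E * k <= e%:E)%E.
  move=> dy k0 ke.
  rewrite (@le_trans _ _ (K%:E * (e / (K + 1))%:E)%E)//.
    apply: lee_pmul => //; first by rewrite lee_fin !divr_ge0// sqr_ge0.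
    rewrite lee_fin /K ler_wpM2l ?divr_ge0 ?sqr_ge0//.
    by rewrite lef_pV2 ?posrE ?ltW// (lt_trans delta0).
  have K1 : 0 < K + 1 by rewrite ltr_wpDl.
  by rewrite -EFinM lee_fin mulrCA ler_piMr ?(ltW e0)// ler_pdivrMr// mul1r lerDl.
(* The exceptional null set contains the points where the limit density is infinite. Elsewhere [h1]
   makes the approximating density finite too, and the estimate becomes one between real numbers. *)
have [A [mA A0 FA]] := Ffin; exists A; split => // y; apply: contra_notP => Ay dy.
have Fy : product_density P f0 V y \is a fin_num.
  by apply: contrapT => Fy; exact: Ay (FA _ Fy).
have y0 : y != 0 by rewrite -normr_gt0 (lt_trans delta0).
have I0 (X : T -> R) : (0 <= \int[P]_w (`|X w|)%:E)%E.
  by apply: integral_ge0 => w _; rewrite lee_fin.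
have h1 := product_density_lip m dx0 dU c0 fL y0 (mZN N) mZ UZNN UZ.
have h2 := product_density_lip m dx0 dU c0 fL y0 mZ (mZN N) UZ UZNN.
have {}h1 := le_trans h1 (leeD2l _ (@bound _ _ dy (I0 _) L1N)).
have {}h2 := le_trans h2 (leeD2l _ (@bound _ _ dy (I0 _) L1N')).
have F0 := product_density_ge0 dx0 (VN N) y.
have FNfin : product_density P f0 (VN N) y \is a fin_num.
  by rewrite ge0_fin_numE// (le_lt_trans h1)// -(fineK Fy) -EFinD ltry.
move: h1 h2 Fy FNfin => /=; rewrite -/(VN N) -/V {F0}.
case: (product_density P f0 (VN N) y) => [s| |]//.
case: (product_density P f0 V y) => [t| |]// + + _ _.
rewrite -!EFinD !lee_fin => h1 h2.
by rewrite /= ler_norml; apply/andP; split; lra.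
Unshelve. all: by end_near. Qed.

End uniform_convergence.

(** * From mean square to mean *)

Section square_integrable.
Context {d : measure_display} {T : measurableType d} {R : realType}.
Variables (mu : {measure set T -> \bar R}) (D : set T) (g : T -> R).
Hypothesis mD : measurable D.
Hypothesis mg : measurable_fun D g.

(** Integrates [|g| <= eta + g ^+ 2 / eta], which follows from [(|g| - eta) ^+ 2 >= 0]. It stands in
    for Cauchy-Schwarz, with [eta] free to be tuned. *)
Lemma integral_normr_le_sqr (eta : R) : 0 < eta ->
  (\int[mu]_(x in D) (`|g x|)%:E <=
    eta%:E * mu D + eta^-1%:E * \int[mu]_(x in D) (g x ^+ 2)%:E)%E.
Proof.
move=> eta0.
have mg2 : measurable_fun D (fun x => (g x ^+ 2)%:E).
  by apply/measurable_EFinP; exact: measurable_funX.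
have ei0 : 0 <= eta^-1 by rewrite invr_ge0 ltW.
rewrite -integral_cst// -ge0_integralZl//; last by move=> x _; rewrite lee_fin sqr_ge0.
rewrite -ge0_integralD//; last 3 first.
- by move=> x _; rewrite lee_fin ltW.
- by move=> x _; rewrite mule_ge0 ?lee_fin ?sqr_ge0.
- exact: measurable_funeM.
apply: ge0_le_integral => //.
- by apply/measurable_EFinP; exact: measurableT_comp.
- by apply: emeasurable_funD => //; exact: measurable_funeM.
move=> x _; rewrite /= -EFinM -EFinD lee_fin.
rewrite -(ler_pM2l eta0) mulrDr mulrA divff ?gt_eqF// mul1r.
have := sqr_ge0 (`|g x| - eta).
rewrite -[g x ^+ 2]real_normK ?num_real//; nra.
Qed.

Lemma integrable_sqr : (mu D < +oo)%E ->
  (\int[mu]_(x in D) (g x ^+ 2)%:E < +oo)%E -> mu.-integrable D (EFin \o g).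
Proof.
move=> Doo g2; apply/integrableP; split; first exact/measurable_EFinP.
rewrite (le_lt_trans (integral_normr_le_sqr ltr01))//.
by rewrite invr1 !mul1e lte_add_pinfty.
Qed.

End square_integrable.

(** * Finite sums of integrable real functions *)

Lemma integrable_Rsum (d : measure_display) (T : measurableType d) (R : realType)
    (mu : {measure set T -> \bar R}) (D : set T) (n : nat) (F : 'I_n -> T -> R) :
  measurable D -> (forall i, mu.-integrable D (EFin \o F i)) ->
  mu.-integrable D (EFin \o (fun x => \sum_(i < n) F i x)).
Proof.
move=> mD iF; rewrite (_ : _ \o _ = fun x => (\sum_(i < n) (EFin \o F i) x)%E).
  exact: integrable_sum.
by apply/funext => x /=; rewrite sumEFin.
Qed.

Lemma Rintegral_sum (d : measure_display) (T : measurableType d) (R : realType)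
    (mu : {measure set T -> \bar R}) (D : set T) (n : nat) (F : 'I_n -> T -> R) :
  measurable D -> (forall i, mu.-integrable D (EFin \o F i)) ->
  Rintegral mu D (fun x => \sum_(i < n) F i x) = \sum_(i < n) Rintegral mu D (F i).
Proof.
move=> mD iF; rewrite /Rintegral.
under eq_integral do rewrite -sumEFin.
rewrite integral_sum//.
rewrite -[RHS]/(fine (\sum_(i < n) fine (\int[mu]_(x in D) (F i x)%:E))%:E).
congr fine; rewrite -sumEFin; apply: eq_bigr => i _.
by rewrite fineK//; apply: integrable_fin_num => //; exact: iF.
Qed.

(** * Time integrals of the Karhunen-Loeve expansion *)

Section karhunen_loeve.
Context {d : measure_display} {T : measurableType d} {R : realType}.
Variables (P : probability T R) (t0 T1 : R) (a : R -> T -> R) (mu : R -> R).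
Variables (nu : nat -> R) (phi : nat -> R -> R) (xi : nat -> T -> R).
Local Notation leb := (@lebesgue_measure R).
Local Notation lebP := (@lebesgue_measure R \x P)%E.
Local Notation D := (`[t0, T1]%classic : set R).
Local Notation DT := (`[t0, T1]%classic `*` [set: T] : set (R * T)).
Hypothesis ma : measurable_fun DT (fun p : R * T => a p.1 p.2).
Hypothesis a2 : (\int[lebP]_(p in DT) ((a p.1 p.2) ^+ 2)%:E < +oo)%E.
Hypothesis mu_ae : {ae leb, forall t, t \in `[t0, T1] ->
  (mu t)%:E = (\int[P]_w (a t w)%:E)%E}.
Hypothesis mphi : forall j, measurable_fun D (phi j).
Hypothesis phi2 : forall j, (\int[leb]_(s in D) (phi j s * phi j s)%:E < +oo)%E.
Hypothesis mxi : forall j, measurable_fun setT (xi j).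
Hypothesis KL : ((fun N : nat => \int[lebP]_(p in DT)
  ((a p.1 p.2 - mu p.1 - \sum_(j < N) Num.sqrt (nu j) * phi j p.1 * xi j p.2) ^+ 2)%:E)
  @ \oo --> 0%E)%E.
Variable t : R.
Hypothesis t0t : t0 < t <= T1.
Local Notation Dt := (`[t0, t]%classic : set R).

Let mDT : measurable (DT : set (measurableTypeR R * T)).
Proof. by apply: measurableX. Qed.

Let lebD : (leb D < +oo)%E.
Proof. by rewrite lebesgue_measure_itv/=; case: ifPn => _; rewrite ?ltry. Qed.

Let lebPDT : (lebP DT < +oo)%E.
Proof.
rewrite product_measure1E// lte_mul_pinfty//.
- by rewrite ge0_fin_numE.
- by rewrite (le_lt_trans (probability_le1 _ _)) ?ltry.
Qed.

Let DtD : Dt `<=` D.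
Proof.
by apply: subset_itvl; rewrite bnd_simp; case/andP: t0t.
Qed.

Let iphi j : leb.-integrable Dt (EFin \o phi j).
Proof.
apply: (@integrableS _ _ _ leb D) => //.
by apply: integrable_sqr => //; [exact: mphi|exact: phi2].
Qed.

Let c j := Num.sqrt (nu j) * Rintegral leb Dt (phi j).

(** Extension of the process by zero, so that Fubini applies on the full product space. *)
Let ap : measurableTypeR R * T -> R := (fun p => a p.1 p.2) \_ DT.

Let m_ap : measurable_fun setT ap.
Proof. by apply: (iffLR (measurable_restrictT _ _)). Qed.

Let iap : lebP.-integrable setT (EFin \o ap).
Proof.
have : lebP.-integrable DT (EFin \o (fun p => a p.1 p.2)) by exact: integrable_sqr.
by move/integrable_mkcond => /(_ mDT); rewrite restrict_EFin.
Qed.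

Let apE s w : D s -> ap (s, w) = a s w.
Proof. by move=> Ds; rewrite /ap patchE mem_set. Qed.

(* a Borel version of [mu], which itself is only determined up to a null set *)
Let mub s := fine (\int[P]_w (ap (s, w))%:E)%E.

Let imub : leb.-integrable setT (EFin \o mub).
Proof.
have iF := integrable_fubini_F iap.
have mF := measurable_int _ iF.
apply: (le_integrable measurableT _ _ iF).
  by apply/measurable_EFinP; exact: measurableT_comp.
move=> s _; rewrite /fubini_F /mub /=.
by case: (\int[P]_w _)%E => [r| |] /=; rewrite ?lexx ?leey.
Qed.

Let mmub : measurable_fun setT mub.
Proof. by have /measurable_EFinP := measurable_int _ imub. Qed.

Let ex_null : exists A : set (measurableTypeR R),
  [/\ measurable A, leb A = 0%E & forall s, D s -> ~ A s -> mub s = mu s].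
Proof.
have [A [mA A0 HA]] := mu_ae; exists A; split => // s Ds As.
have : (mu s)%:E = (\int[P]_w (a s w)%:E)%E.
  by apply: contrapT => H; apply: As; apply: HA => /= H'; apply: H; exact: H'.
move=> mus; rewrite /mub.
by under eq_integral do rewrite apE//; rewrite -mus.
Qed.

Let m := Rintegral leb Dt mub.

Let term_integrable N (x : 'I_N -> R) :
  leb.-integrable Dt (EFin \o (fun s => mub s + \sum_(j < N) Num.sqrt (nu j) * phi j s * x j)).
Proof.
apply: (@integrableD _ _ _ leb Dt _ (EFin \o mub)
   (EFin \o (fun s => \sum_(j < N) Num.sqrt (nu j) * phi j s * x j))) => //.
  exact: (integrableS measurableT).
apply: integrable_Rsum => // j.
rewrite (_ : _ \o _ = fun s => (Num.sqrt (nu j) * x j)%:E * (EFin \o phi j) s)%E.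
  exact: integrableZl.
by apply/funext => s /=; rewrite -EFinM; congr EFin; ring.
Qed.

Let term_Rintegral N (x : 'I_N -> R) :
  Rintegral leb Dt (fun s => mub s + \sum_(j < N) Num.sqrt (nu j) * phi j s * x j) =
  m + \sum_(j < N) c j * x j.
Proof.
have iZ (j : 'I_N) : leb.-integrable Dt (EFin \o (fun s => Num.sqrt (nu j) * phi j s * x j)).
  rewrite (_ : _ \o _ = fun s => (Num.sqrt (nu j) * x j)%:E * (EFin \o phi j) s)%E.
    exact: integrableZl.
  by apply/funext => s /=; rewrite -EFinM; congr EFin; ring.
rewrite RintegralD//; last 2 first.
- exact: (integrableS measurableT).
- exact: integrable_Rsum.
congr (_ + _); rewrite Rintegral_sum//; apply: eq_bigr => j _.
rewrite /c (_ : (fun s => _) = fun s => Num.sqrt (nu j) * x j * phi j s); last first.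
  by apply/funext => s; ring.
by rewrite RintegralZl//; ring.
Qed.

(** [mu] is not known to be measurable, so it is first exchanged for [mub] off a null set; linearity
    then applies. *)
Let K_aE N (v : N.-tuple R) :
  K_a mu nu phi t0 t v = m + \sum_(j < N) c j * tnth v j.
Proof.
have [A [mA A0 HA]] := ex_null.
rewrite -term_Rintegral /K_a /Rintegral; congr fine.
by apply: (eq_integral_off_null mA A0) => s /DtD Ds As; rewrite HA.
Qed.

Let pathint w := Rintegral leb Dt (fun s => a s w).

(** The path integral is a section integral of the zero-extended process, which is integrable
    because it is square integrable on a set of finite measure; Fubini gives measurability. *)
Let mpathint : measurable_fun setT pathint.
Proof.
pose g : measurableTypeR R * T -> \bar R := (EFin \o ap) \_ (Dt `*` setT).
have mDtT : measurable (Dt `*` setT : set (measurableTypeR R * T)) by exact: measurableX.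
have ig : lebP.-integrable setT g.
  apply: (iffLR (integrable_mkcond _ mDtT)).
  exact: (integrableS measurableT mDtT (@subsetT _ _) iap).
rewrite (_ : pathint = fine \o fubini_G leb g).
  by apply: (measurableT_comp _ (measurable_fubini_G ig)).
apply/funext => w; rewrite /pathint /Rintegral /=; congr fine.
rewrite integral_mkcond; apply: eq_integral => s _.
rewrite /g !patchE in_setX/= in_setT andbT; case: ifPn => // /set_mem sDt.
by rewrite /= apE//; exact: DtD.
Qed.

(** The truncation error of the expansion, made jointly measurable everywhere by using [mub] and
    extending all terms by zero. *)
Let resid N (p : measurableTypeR R * T) : R :=
  (ap p - (mub \_ D) p.1 - \sum_(j < N) Num.sqrt (nu j) * (phi j \_ D) p.1 * xi j p.2).

Let mresid N : measurable_fun setT (resid N).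
Proof.
have mD : measurable (D : set (measurableTypeR R)) by [].
apply: measurable_funB; first apply: measurable_funB => //.
  apply: (measurableT_comp _ measurable_fst).
  by apply: (iffLR (measurable_restrictT _ _)) => //; exact: measurable_funTS.
apply: measurable_sum => j; apply: measurable_funM; last exact: (measurableT_comp (mxi j) measurable_snd).
apply: measurable_funM => //; apply: (measurableT_comp _ measurable_fst).
by apply: (iffLR (measurable_restrictT _ _)) => //; exact: mphi.
Qed.

Let resid_integral N : (\int[lebP]_(p in DT) (resid N p ^+ 2)%:E =
  \int[lebP]_(p in DT)
  ((a p.1 p.2 - mu p.1 - \sum_(j < N) Num.sqrt (nu j) * phi j p.1 * xi j p.2) ^+ 2)%:E)%E.
Proof.
have [A [mA A0 HA]] := ex_null.
have AT0 : lebP (A `*` setT) = 0%E by rewrite product_measure1E// [X in (X * _)%E]A0 mul0e.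
have mAT : measurable (A `*` setT : set (measurableTypeR R * T)) by exact: measurableX.
apply: (eq_integral_off_null mAT AT0).
move=> [s w] [/= Ds _] Asw; rewrite /resid /=.
have As : ~ A s by move=> As; apply: Asw.
rewrite apE// patchE mem_set// HA//; congr ((_ - _) ^+ 2)%:E.
by apply: eq_bigr => j _; rewrite patchE mem_set.
Qed.

Let resid_out N s w : ~ D s -> resid N (s, w) = 0.
Proof.
move=> Ds; have sD : s \in D = false by apply: memNset.
rewrite /resid /ap !patchE in_setX/= sD/= subrr big1 ?subr0// => j _.
by rewrite patchE sD mulr0 mul0r.
Qed.

(** On the finite measure space [DT], mean-square convergence implies convergence in mean. *)
Let resid_L1 e : 0 < e ->
  \forall N \near \oo, (\int[lebP]_p (`|resid N p|)%:E <= e%:E)%E.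
Proof.
move=> e0.
pose K := fine (lebP DT).
have KE : lebP DT = K%:E by rewrite fineK// ge0_fin_numE.
have K0 : 0 <= K by exact: fine_ge0.
have K1 : 0 < K + 1 by rewrite ltr_wpDl.
(* Chosen so that [eta * K <= e / 2]; a second moment below [eta * (e / 2)] then contributes at most
   the other half. *)
pose eta := e / 2 / (K + 1).
have eta0 : 0 < eta by rewrite !divr_gt0.
have ee0 : 0 < eta * (e / 2) by rewrite mulr_gt0// divr_gt0.
have eD : (\forall N \near \oo, (\int[lebP]_(p in DT) (resid N p ^+ 2)%:E < (eta * (e / 2))%:E)%E).
  have /fine_cvgP[KLfin /cvgr_lt /(_ _ ee0) KLlt] := KL.
  near=> N; rewrite resid_integral -[ltLHS]fineK; last by near: N.
  by rewrite lte_fin; near: N.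
move: eD; apply: filterS => N remN.
have -> : (\int[lebP]_p (`|resid N p|)%:E = \int[lebP]_(p in DT) (`|resid N p|)%:E)%E.
  rewrite [RHS]integral_mkcond; apply: eq_integral => -[s w] _.
  rewrite patchE; case: ifPn => // sD; rewrite resid_out ?normr0// => Ds.
  by move/negP: sD; apply; apply: mem_set.
have mrD := @measurable_funTS _ _ _ _ DT _ (mresid N).
rewrite (le_trans (integral_normr_le_sqr lebP mDT mrD eta0))//.
rewrite [in leRHS](splitr e) EFinD; apply: leeD.
  rewrite [X in (_ * X)%E]KE -EFinM lee_fin /eta mulrAC ler_pdivrMr// ler_wpM2l ?divr_ge0 ?(ltW e0)//.
  by rewrite lerDl.
rewrite (@le_trans _ _ (eta^-1%:E * (eta * (e / 2))%:E)%E)//.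
  by rewrite lee_wpmul2l ?lee_fin ?invr_ge0 ?(ltW eta0)// ltW.
by rewrite -EFinM lee_fin mulKf// gt_eqF.
Unshelve. all: by end_near. Qed.

(** For almost every path, the error of the integrated expansion is at most the time integral of
    [|resid N|]. By Tonelli its mean is at most the L1 norm of [resid N]. *)
Lemma karhunen_loeve_L1 : exists m : R,
  [/\ forall N (v : N.-tuple R), K_a mu nu phi t0 t v =
        m + \sum_(j < N) Num.sqrt (nu j) * Rintegral leb Dt (phi j) * tnth v j,
      measurable_fun setT (fun w => Rintegral leb Dt (fun s => a s w)) &
      forall e, 0 < e -> \forall N \near \oo,
        (\int[P]_w (`|m + \sum_(j < N)
              Num.sqrt (nu j) * Rintegral leb Dt (phi j) * xi j w
            - Rintegral leb Dt (fun s => a s w)|)%:E <= e%:E)%E].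
Proof.
exists m; split => // e e0.
have := resid_L1 e0; apply: filterS => N; apply: le_trans.
rewrite fubini_tonelli2//; last first.
  by apply/measurable_EFinP; exact: measurableT_comp.
apply: ae_ge0_le_integral => //.
- apply/measurable_EFinP; apply: measurableT_comp => //; apply: measurable_funB => //.
  apply: measurable_funD => //; apply: measurable_sum => j; exact: measurable_funM.
- by move=> w _; apply: integral_ge0 => s _; rewrite lee_fin.
- apply: measurable_fun_fubini_tonelli_G => //.
  by apply/measurable_EFinP; exact: measurableT_comp.
(* Off this null set the path is integrable, so the difference of the two time integrals is the
   integral of the difference. *)
have [A [mA A0 HA]] := ae_integrable2 iap.
exists A; split => // w; apply: contra_notP => Aw _ /=.
have iw : leb.-integrable setT (fun s => (ap (s, w))%:E).
  by apply: contrapT => h; exact: Aw (HA _ h).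
have apath : pathint w = Rintegral leb Dt (fun s => ap (s, w)).
  by apply: eq_Rintegral => s /set_mem/DtD Ds; rewrite apE.
have iwt : leb.-integrable Dt (EFin \o (fun s => ap (s, w))).
  exact: (integrableS measurableT _ (@subsetT _ _) iw).
have iterm := term_integrable (fun j : 'I_N => xi j w).
rewrite -(term_Rintegral (fun j : 'I_N => xi j w)) -/(pathint w) apath -RintegralB//.
have mDt : measurable (Dt : set (measurableTypeR R)) by [].
have idiff := integrableB mDt iterm iwt.
rewrite EFin_normr_Rintegral//.
apply: (le_trans (le_abse_integral _ _ _)) => //.
  exact: measurable_int idiff.
apply: (@le_trans _ _ (\int[leb]_(s in Dt) (`|resid N (s, w)|)%:E)%E); last first.
  apply: ge0_subset_integral => //.
  apply/measurable_EFinP; apply: measurableT_comp => //.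
  exact: (measurableT_comp (mresid N) (pair2_measurable w)).
rewrite le_eqVlt; apply/orP; left; apply/eqP; apply: eq_integral => s /set_mem/DtD Ds.
rewrite /= /resid /= patchE mem_set// -normrN; congr (`| _ |%:E).
under [in RHS]eq_bigr do rewrite patchE mem_set//.
by ring.
Qed.

End karhunen_loeve.

(** * Application to the solution process *)

Theorem theorem5 (d : measure_display) (T : measurableType d) (R : realType)
  (P : probability T R) (t0 T1 : R) (x0 : T -> R) (a : R -> T -> R)
  (mu : R -> R) (nu : nat -> R) (phi : nat -> R -> R) (xi : nat -> T -> R)
  (f0 fxi1 : R -> R) (fxiN : forall N : nat, N.-tuple R -> R) :
  (* complete probability space, t0 < T *)
  measure_is_complete P ->
  t0 < T1 ->
  (* (H1) a in L^2([t0,T] x Omega) *)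
  measurable_fun (`[t0, T1] `*` setT) (fun p : R * T => a p.1 p.2) ->
  (\int[(@lebesgue_measure R \x P)%E]_(p in `[t0, T1] `*` setT)
      ((a p.1 p.2) ^+ 2)%:E < +oo)%E ->
  (* Karhunen-Loeve expansion of a (indices shifted: Rocq j = paper j+1) *)
  {ae @lebesgue_measure R, forall t, t \in `[t0, T1] ->
      (mu t)%:E = (\int[P]_w (a t w)%:E)%E} ->
  (forall j, 0 <= nu j) ->
  (forall j, measurable_fun `[t0, T1] (phi j)) ->
  (forall i j, (\int[@lebesgue_measure R]_(s in `[t0, T1]) (phi i s * phi j s)%:E)%E
                = ((i == j)%:R)%:E) ->
  (forall g : R -> R, measurable_fun `[t0, T1] g ->
     (\int[@lebesgue_measure R]_(s in `[t0, T1]) ((g s) ^+ 2)%:E < +oo)%E ->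
     (forall j, (\int[@lebesgue_measure R]_(s in `[t0, T1]) (g s * phi j s)%:E)%E = 0%E) ->
     {ae @lebesgue_measure R, forall s, s \in `[t0, T1] -> g s = 0}) ->
  (forall j, {ae @lebesgue_measure R, forall t, t \in `[t0, T1] ->
      Rintegral (@lebesgue_measure R) `[t0, T1]
        (fun s => covariance_fn P a mu t s * phi j s) = nu j * phi j t}) ->
  (forall j, measurable_fun setT (xi j)) ->
  (forall j, (\int[P]_w (xi j w)%:E)%E = 0%E) ->
  (forall j, (\int[P]_w ((xi j w) ^+ 2)%:E)%E = 1%E) ->
  (forall i j, i != j -> (\int[P]_w (xi i w * xi j w)%:E)%E = 0%E) ->
  ((fun N : nat =>
      \int[(@lebesgue_measure R \x P)%E]_(p in `[t0, T1] `*` setT)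
        ((a p.1 p.2 - mu p.1
          - \sum_(j < N) Num.sqrt (nu j) * phi j p.1 * xi j p.2) ^+ 2)%:E)
     @ \oo --> 0%E)%E ->
  0 < nu 0%N ->
  (* densities: f0 of x0, fxi1 of xi_1, fxiN N of xi_N = (xi_1,...,xi_N) *)
  is_density P x0 f0 ->
  is_density P (xi 0%N) fxi1 ->
  (forall N : nat, (0 < N)%N -> is_densityN P (xivec xi N) (fxiN N)) ->
  (* (H2) for N >= 2: x0, xi_1, (xi_2..xi_N) absolutely continuous, independent *)
  (forall N : nat, (2 <= N)%N ->
     (exists g : N.-1.-tuple R -> R, is_densityN P (xitail xi N) g) /\
     (forall (A B : set R) (C : set (N.-1.-tuple R)),
        measurable A -> measurable B -> measurable C ->
        P (x0 @^-1` A `&` xi 0%N @^-1` B `&` xitail xi N @^-1` C)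
        = (P (x0 @^-1` A) * P (xi 0%N @^-1` B) * P (xitail xi N @^-1` C))%E)) ->
  (* (H3) f_{xi_1} Lipschitz on R *)
  (exists L : R, forall y z, `|fxi1 y - fxi1 z| <= L * `|y - z|) ->
  (* (H4) *)
  (forall t, t0 < t <= T1 ->
     Rintegral (@lebesgue_measure R) `[t0, t] (phi 0%N) != 0) ->
  (* conclusion *)
  forall t, t0 < t <= T1 ->
  exists f1 : R -> R,
    is_density P (sol x0 a t0 t) f1 /\
    forall (delta : R) (J : set R), 0 < delta ->
      (exists M : R, forall y, J y -> `|y| <= M) ->
      (forall y, J y -> delta < `|y|) ->
      forall e : R, 0 < e ->
        \forall N \near \oo,
          {ae @lebesgue_measure R, forall y, J y ->
             (`| f1N f0 mu nu phi t0 t (fxiN N) y - (f1 y)%:E | <= e%:E)%E}.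
Proof.
move=> _ _ ma a2 mu_ae _ mphi ortho _ _ mxi _ _ _ KL nu0 dx0 dxi1 dN H2 [L fL] H4 t tt.
have phi2 j : (\int[@lebesgue_measure R]_(s in `[t0, T1]) (phi j s * phi j s)%:E < +oo)%E.
  by rewrite ortho eqxx ltry.
have [m [KE mA L1]] := karhunen_loeve_L1 ma a2 mu_ae mphi phi2 mxi KL tt.
pose c j := Num.sqrt (nu j) * Rintegral (@lebesgue_measure R) `[t0, t] (phi j).
have c0 : c 0%N != 0 by rewrite mulf_neq0 ?H4// gt_eqF// sqrtr_gt0.
pose A w := Rintegral (@lebesgue_measure R) `[t0, t] (fun s => a s w).
(* The tail vector starts at [xi 1], hence the shifted coefficients. *)
pose lin N (v : N.-1.-tuple R) := \sum_(i < N.-1) c i.+1 * tnth v i.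
pose ZN N w := lin N (xitail xi N w).
pose Z w := A w - m - c 0%N * xi 0%N w.
have mlin N : measurable_fun setT (lin N).
  by apply: measurable_sum => i; apply: measurable_funM => //; exact: measurable_tnth.
have ZNE N w : ZN N w = \sum_(i < N.-1) c i.+1 * xi i.+1 w.
  by apply: eq_bigr => i _; rewrite tnth_mktuple.
have mZN N : measurable_fun setT (ZN N).
  rewrite (_ : ZN N = fun w => \sum_(i < N.-1) c i.+1 * xi i.+1 w); last first.
    by apply/funext => w; exact: ZNE.
  by apply: measurable_sum => i; exact: measurable_funM.
have mZ : measurable_fun setT Z.
  apply: measurable_funB; first exact: measurable_funB.
  exact: measurable_funM.
(* At [N = 0] the left sum is empty while the right side still contains the [xi 0] term, so [N] must
   be positive. *)
have VNE N w : (0 < N)%N ->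
    m + \sum_(j < N) c j * xi j w = m + c 0%N * xi 0%N w + ZN N w.
  by case: N => // N _; rewrite ZNE big_ord_recl addrA.
have indepN : \forall N \near \oo, forall B B' C,
    measurable B -> measurable B' -> measurable C ->
    P (x0 @^-1` B `&` xi 0%N @^-1` B' `&` ZN N @^-1` C) =
      (P (x0 @^-1` B) * P (xi 0%N @^-1` B') * P (ZN N @^-1` C))%E.
  exists 2%N => // N /= N2 B B' C mB mB' mC.
  have [_ /(_ B B' (lin N @^-1` C) mB mB')] := H2 N N2; apply.
  by rewrite -[X in measurable X]setTI; exact: mlin.
have L1' e : 0 < e -> \forall N \near \oo, (\int[P]_w (`|ZN N w - Z w|)%:E <= e%:E)%E.
  move=> e0; near=> N.
  have -> : (\int[P]_w (`|ZN N w - Z w|)%:E =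
      \int[P]_w (`|m + \sum_(j < N) c j * xi j w - A w|)%:E)%E.
    apply: eq_integral => w _; rewrite VNE; last by near: N; exists 1%N.
    by congr (`| _ |%:E); rewrite /Z; ring.
  by near: N; exact: L1.
have [f1 [df1 f1P]] :=
  product_density_cvg m dx0 dxi1 c0 fL mZ mZN indepN L1'.
exists f1; split.
  rewrite (_ : sol _ _ _ _ = fun w => x0 w * expR (m + c 0%N * xi 0%N w + Z w))//.
  by apply/funext => w; rewrite /sol -/(A w); congr (_ * expR _); rewrite /Z; ring.
move=> delta J delta0 _ Jdelta e e0; near=> N.
have N0 : (0 < N)%N by near: N; exists 1%N.
(* Integrating against the density of [xivec xi N] is taking an expectation, and the remaining
   factors of the integrand form [dilate f0 y] at the value of [K_a]. *)
have f1NE y : f1N f0 mu nu phi t0 t (fxiN N) y =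
    product_density P f0 (fun w => m + c 0%N * xi 0%N w + ZN N w) y.
  rewrite /f1N.
  have mK : measurable_fun setT (fun v : N.-tuple R => m + \sum_(j < N) c j * tnth v j).
    apply: measurable_funD => //; apply: measurable_sum => i.
    by apply: measurable_funM => //; exact: measurable_tnth.
  transitivity (lebesgue_integralN (fun v : N.-tuple R =>
      (dilate f0 y (m + \sum_(j < N) c j * tnth v j) * fxiN N v)%:E)).
    congr lebesgue_integralN; apply/funext => v; congr EFin.
    by rewrite KE /dilate mulrAC.
  rewrite (lebesgue_integralN_density (dN N N0)); last 2 first.
  - exact: (measurable_dilate dx0).
  - by move=> v; exact: (dilate_ge0 dx0).
  apply: eq_integral => w _; rewrite -VNE//; congr (dilate _ _ (_ + _))%:E.
  by apply: eq_bigr => j _; rewrite tnth_mktuple.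
have [B [mB B0 HB]] : {ae @lebesgue_measure R, forall y, delta < `|y| ->
    (`| product_density P f0 (fun w => m + c 0%N * xi 0%N w + ZN N w)%R y - (f1 y)%:E |
      <= e%:E)%E}.
  by near: N; exact: f1P.
exists B; split => // y; apply: contra_notP => By Jy; rewrite f1NE.
by apply: contrapT => H; apply: By; apply: HB => /= H'; apply: H; exact/H'/Jdelta.
Unshelve. all: by end_near. Qed.
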